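(* Let $q\in\mathcal P$ be conformal at the boundary point $1$ with $q(1)=0$, and put $\alpha=-q'(1)$ (which is a positive real number). Let $\gamma\in\mathbb C$ satisfy $\operatorname{Re}\gamma\ge\frac{\alpha}{2}$. Then there exist functions $\{q_\tau\}_{\tau\in\Delta}\subset\mathcal P$ which converge to $q$ uniformly on compact subsets of $\Delta$ as $\tau$ tends to $1$ unrestrictedly, and such that for all $\tau\in\Delta$ $$q_\tau(\tau)=\gamma\,(1-|\tau|^2)\quad(\to 0\ \text{ as }\ \tau\to1).$$ In particular, if $\gamma$ is real and $\gamma\ge\frac{\alpha}{2}$, the values $q_\tau(\tau)$ are real numbers.
   Context: $\Delta=\{z\in\mathbb C:|z|<1\}$. $\mathcal P$ is the set of holomorphic functions $p$ on $\Delta$ with $\operatorname{Re}p(z)\ge0$ for all $z\in\Delta$. $\angle\lim$ denotes the angular (non-tangential) limit. For $q\in\mathcal P$, $q(1)=\angle\lim_{z\to1}q(z)$, and when $q(1)=0$ the angular derivative is $q'(1)=\angle\lim_{z\to1}\frac{q(z)}{z-1}$; $q$ is conformal at $1$ if $q'(1)$ exists finitely and $q'(1)\ne0$. (For $q\in\mathcal P$ conformal at $1$ with $q(1)=0$, $q'(1)$ is a negative real number.) ''$\tau\to1$ unrestrictedly'' means $\tau\in\Delta$, $|\tau-1|\to0$, with no restriction on the manner of approach. *)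

(* Defs.v *)
From Stdlib Require Import Reals List.
From Coquelicot Require Import Coquelicot.

Local Open Scope R_scope.

Definition unit_disc (z : C) : Prop := Cmod z < 1.

(* Only the values on [unit_disc] matter: functions on the disc are total functions
   [C -> C], and complex differentiability at the points of the open set [unit_disc]
   does not depend on the values outside it. *)
Definition holomorphic_on_disc (f : C -> C) : Prop :=
  forall z : C, unit_disc z -> @ex_derive C_AbsRing C_NormedModule f z.

Definition classP (p : C -> C) : Prop :=
  holomorphic_on_disc p /\ (forall z : C, unit_disc z -> 0 <= Re (p z)).

(* Stolz (non-tangential approach) region of aperture [M] with vertex 1. *)
Definition Stolz (M : R) (z : C) : Prop :=
  unit_disc z /\ Cmod (1 - z)%C < M * (1 - Cmod z).

(* The filter "z tends to 1 inside D". *)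
Definition to_one (D : C -> Prop) : (C -> Prop) -> Prop :=
  within D (locally (RtoC 1)).

Definition angular_lim (f : C -> C) (l : C) : Prop :=
  forall M : R, 1 < M -> filterlim f (to_one (Stolz M)) (locally l).

(* Meaningful when the angular limit of [q] at 1 is 0. *)
Definition angular_derivative (q : C -> C) (d : C) : Prop :=
  angular_lim (fun z : C => (q z / (z - 1))%C) d.

Definition conformal_at_one (q : C -> C) : Prop :=
  exists d : C, angular_derivative q d /\ d <> RtoC 0.

Definition compactC (K : C -> Prop) : Prop :=
  forall (I : Type) (U : I -> C -> Prop),
    (forall i : I, open (U i)) ->
    (forall z : C, K z -> exists i : I, U i z) ->
    exists l : list I, forall z : C, K z -> exists i : I, In i l /\ U i z.

(* Uniform convergence on compact subsets of [unit_disc], along a filter [F]. *)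
Definition cvg_loc_unif (F : (C -> Prop) -> Prop) (f : C -> C -> C) (g : C -> C)
    : Prop :=
  forall K : C -> Prop, compactC K -> (forall z : C, K z -> unit_disc z) ->
  forall eps : R, 0 < eps ->
    F (fun tau : C => forall z : C, K z -> Cmod (f tau z - g z)%C < eps).

(* Main.v *)
Require Import Defs.
From Stdlib Require Import Reals List.
From Stdlib Require Import Lra Lia Psatz Classical ClassicalEpsilon.
From Coquelicot Require Import Coquelicot.

(** Write a for the positive number alpha.  The idea is to pass to 1 / q, which also
    has positive real part.  Julia's inequality ([julia_inequality]) gives
    Re (1 / q) >= m Re ((1 + z) / (1 - z)) with m = 1 / (2 a), so that
    1 / q = m (1 + z) / (1 - z) + p with Re p >= 0 ([remainder_classP]): the
    angular derivative is seen as a point mass m at 1 of the Herglotz measure of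
    1 / q.  Moving this mass slightly, replacing the kernel (1 + z) / (1 - z) by
    (1 + om z) / (1 - om z) with |om| <= 1 close to 1, changes 1 / q little on
    compact sets, but near 1 it changes everything: multiplied by 1 - |tau|^2, the
    values of m (1 + om tau) / (1 - om tau) for |om| <= 1 nearly fill the disc of
    centre 1 / a and radius 1 / a.  The number 1 / gamma lies in this closed disc
    precisely when Re gamma >= a / 2.  A small increase of the mass provides the
    room needed when 1 / gamma is on the boundary, and a dilation of p makes its
    contribution at tau negligible; solving for om then gives the exact value
    1 / (gamma (1 - |tau|^2)) at tau ([interpolating_approximant]).  A diagonal
    choice over the accuracies yields one family ([diagonal_family]).

    Julia's inequality is the limit at 1 of the two-point Pick inequality
    ([pick_inequality]), itself Schwarz's lemma and so a consequence of the maximum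
    principle.  The latter is derived from the bare existence of the complex
    derivative: Goursat's subdivision argument, in real form
    ([divergence_free_flux_zero]) and in logarithmic polar coordinates, shows that
    the means over concentric circles agree ([mean_value_circle]), and the mean
    value property excludes interior maxima.

    That alpha is real and positive follows by letting z approach 1 along all
    nontangential lines ([angular_derivative_halfplane]). *)

Local Open Scope R_scope.

(** * Differentiable vector fields of zero divergence *)

Lemma choice_function (A B : Type) (R : A -> B -> Prop) :
  (forall x, exists y, R x y) -> exists f, forall x, R x (f x).
Proof.
  intros H; exists (fun x => proj1_sig (constructive_indefinite_description _ (H x))).
  intros x; apply proj2_sig.
Qed.

Lemma nested_intervals (a l : nat -> R) :
  (forall n, 0 <= l n) ->
  (forall n, a n <= a (S n)) ->
  (forall n, a (S n) + l (S n) <= a n + l n) ->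
  exists x, forall n, a n <= x <= a n + l n.
Proof.
  intros Hl Ha Hb.
  assert (Hmono : forall n k, a n <= a (n + k)%nat).
  { intros n k; induction k as [|k IH].
    - rewrite Nat.add_0_r; lra.
    - rewrite Nat.add_succ_r; specialize (Ha (n + k)%nat); lra. }
  assert (Hanti : forall n k, a (n + k)%nat + l (n + k)%nat <= a n + l n).
  { intros n k; induction k as [|k IH].
    - rewrite Nat.add_0_r; lra.
    - rewrite Nat.add_succ_r; specialize (Hb (n + k)%nat); lra. }
  assert (Hcross : forall n k, a k <= a n + l n).
  { intros n k; destruct (Nat.le_ge_cases n k) as [H|H].
    - specialize (Hanti n (k - n)%nat).
      replace (n + (k - n))%nat with k in Hanti by lia.
      specialize (Hl k); lra.
    - specialize (Hmono k (n - k)%nat).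
      replace (k + (n - k))%nat with n in Hmono by lia.
      specialize (Hl n); lra. }
  destruct (completeness (fun y => exists n, y = a n)) as [x [Hub Hlub]].
  - exists (a O + l O); intros y [n ->]; apply Hcross.
  - exists (a O), O; reflexivity.
  - exists x; intros n; split.
    + apply Hub; now exists n.
    + apply Hlub; intros y [k ->]; apply Hcross.
Qed.

(** The induction principle behind Goursat's argument: a property that passes
    from the four quarters of a rectangle to the rectangle, and that holds for all
    small rectangles containing a given point, holds for every rectangle.
    Otherwise nested bad quarters would shrink to a point, contradicting the
    local hypothesis there.  The tag point has to lie in the small rectangle:
    differentiability controls errors relative to the distance from it, so a
    covering argument with tags outside the cells would be too weak. *)
Lemma quadrisection_induction (P : R -> R -> R -> R -> Prop) (a0 c0 l0 m0 : R) :
  0 < l0 -> 0 < m0 ->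
  (forall a c l m,
     P a c (l / 2) (m / 2) -> P (a + l / 2) c (l / 2) (m / 2) ->
     P a (c + m / 2) (l / 2) (m / 2) -> P (a + l / 2) (c + m / 2) (l / 2) (m / 2) ->
     P a c l m) ->
  (forall x y, exists del, 0 < del /\ forall a c l m,
     0 < l < del -> 0 < m < del -> a <= x <= a + l -> c <= y <= c + m ->
     P a c l m) ->
  P a0 c0 l0 m0.
Proof.
  intros Hl0 Hm0 Hglue Hloc.
  apply NNPP; intros Hnot.
  pose (bad := fun k => fun p : R * R =>
    ~ P (fst p) (snd p) (l0 * (/ 2) ^ k) (m0 * (/ 2) ^ k)).
  assert (Hstep : forall k p, bad k p -> exists p', bad (S k) p' /\
    (fst p' = fst p \/ fst p' = fst p + l0 * (/ 2) ^ S k) /\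
    (snd p' = snd p \/ snd p' = snd p + m0 * (/ 2) ^ S k)).
  { intros k [a c] Hbad; unfold bad in *; cbn [fst snd] in *.
    apply NNPP; intros Hno; apply Hbad.
    assert (El : l0 * (/ 2) ^ k / 2 = l0 * (/ 2) ^ S k) by (simpl; field).
    assert (Em : m0 * (/ 2) ^ k / 2 = m0 * (/ 2) ^ S k) by (simpl; field).
    apply Hglue; rewrite El, Em; apply NNPP; intros HP; apply Hno;
      [ exists (a, c) | exists (a + l0 * (/ 2) ^ S k, c)
      | exists (a, c + m0 * (/ 2) ^ S k)
      | exists (a + l0 * (/ 2) ^ S k, c + m0 * (/ 2) ^ S k) ];
      cbn [fst snd]; auto. }
  pose (T := { kp : nat * (R * R) | bad (fst kp) (snd kp) }).
  assert (Hchoice : exists next : T -> T, forall s,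
       fst (proj1_sig (next s)) = S (fst (proj1_sig s)) /\
       let p := snd (proj1_sig s) in let p' := snd (proj1_sig (next s)) in
       let k := fst (proj1_sig s) in
       (fst p' = fst p \/ fst p' = fst p + l0 * (/ 2) ^ S k) /\
       (snd p' = snd p \/ snd p' = snd p + m0 * (/ 2) ^ S k)).
  { apply choice_function with (R := fun s s' : T =>
       fst (proj1_sig s') = S (fst (proj1_sig s)) /\
       let p := snd (proj1_sig s) in let p' := snd (proj1_sig s') in
       let k := fst (proj1_sig s) in
       (fst p' = fst p \/ fst p' = fst p + l0 * (/ 2) ^ S k) /\
       (snd p' = snd p \/ snd p' = snd p + m0 * (/ 2) ^ S k)).
    intros [[k p] Hb]; cbn [fst snd proj1_sig] in *.
    destruct (Hstep k p Hb) as [p' [Hb' H']].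
    exists (exist _ (S k, p') Hb'); cbn [fst snd proj1_sig]; auto. }
  destruct Hchoice as [next Hnext].
  assert (H00 : bad O (a0, c0)).
  { unfold bad; simpl; now rewrite !Rmult_1_r. }
  pose (s := fix s n := match n with
     | O => exist (fun kp : nat * (R * R) => bad (fst kp) (snd kp)) (O, (a0, c0)) H00
     | S n => next (s n) end).
  assert (Hk : forall n, fst (proj1_sig (s n)) = n).
  { induction n as [|n IH]; [reflexivity|].
    change (s (S n)) with (next (s n)).
    now rewrite (proj1 (Hnext (s n))), IH. }
  assert (Hpow : forall n, 0 < (/ 2) ^ n) by (intros; apply pow_lt; lra).
  assert (Hhalf : forall n, (/ 2) ^ n = 2 * (/ 2) ^ S n) by (intros; simpl; field).
  destruct (nested_intervals (fun n => fst (snd (proj1_sig (s n))))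
              (fun n => l0 * (/ 2) ^ n)) as [x Hx].
  { intros n; specialize (Hpow n); nra. }
  { intros n; change (s (S n)) with (next (s n)).
    destruct (proj1 (proj2 (Hnext (s n)))) as [-> | ->]; [lra|].
    specialize (Hpow (S (fst (proj1_sig (s n))))); nra. }
  { intros n; change (s (S n)) with (next (s n)).
    destruct (proj1 (proj2 (Hnext (s n)))) as [-> | ->];
      rewrite ?Hk, (Hhalf n); specialize (Hpow (S n)); nra. }
  destruct (nested_intervals (fun n => snd (snd (proj1_sig (s n))))
              (fun n => m0 * (/ 2) ^ n)) as [y Hy].
  { intros n; specialize (Hpow n); nra. }
  { intros n; change (s (S n)) with (next (s n)).
    destruct (proj2 (proj2 (Hnext (s n)))) as [-> | ->]; [lra|].
    specialize (Hpow (S (fst (proj1_sig (s n))))); nra. }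
  { intros n; change (s (S n)) with (next (s n)).
    destruct (proj2 (proj2 (Hnext (s n)))) as [-> | ->];
      rewrite ?Hk, (Hhalf n); specialize (Hpow (S n)); nra. }
  destruct (Hloc x y) as [del [Hdel HP]].
  assert (Hlim : exists n, (l0 + m0) * (/ 2) ^ n < del).
  { destruct (pow_lt_1_zero (/ 2)) with (y := del / (l0 + m0)) as [n Hn].
    - rewrite Rabs_pos_eq; lra.
    - apply Rdiv_lt_0_compat; lra.
    - exists n; specialize (Hn n (le_n n)).
      rewrite Rabs_pos_eq in Hn by (left; apply Hpow).
      apply Rmult_lt_compat_l with (r := l0 + m0) in Hn; [|lra].
      replace ((l0 + m0) * (del / (l0 + m0))) with del in Hn by (field; lra).
      exact Hn. }
  destruct Hlim as [n Hn].
  pose proof (proj2_sig (s n)) as Hbad; unfold bad in Hbad.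
  rewrite Hk in Hbad.
  specialize (Hpow n).
  apply Hbad, HP; [ nra | nra | apply Hx | apply Hy ].
Qed.

(** The outward flux of the field (U, - V) through the rectangle with lower left
    corner (a, c) and sides l, m; it is the imaginary part of the contour integral
    of U + i V. *)
Definition flux (U V : R -> R -> R) (a c l m : R) : R :=
  RInt (fun x => V x c - V x (c + m)) a (a + l) +
  RInt (fun y => U (a + l) y - U a y) c (c + m).

Lemma continuity_2d_pt_continuous_fst U x y :
  continuity_2d_pt U x y -> continuous (fun u => U u y) x.
Proof.
  intros H; apply continuity_pt_filterlim; intros eps Heps.
  destruct (H (mkposreal eps Heps)) as [d Hd].
  exists d; split; [apply cond_pos|].
  intros u [_ Hu]; apply Hd; [exact Hu|].
  rewrite Rminus_eq_0, Rabs_R0; apply cond_pos.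
Qed.

Lemma continuity_2d_pt_continuous_snd U x y :
  continuity_2d_pt U x y -> continuous (fun v => U x v) y.
Proof.
  intros H; apply continuity_pt_filterlim; intros eps Heps.
  destruct (H (mkposreal eps Heps)) as [d Hd].
  exists d; split; [apply cond_pos|].
  intros u [_ Hu]; apply Hd; [|exact Hu].
  rewrite Rminus_eq_0, Rabs_R0; apply cond_pos.
Qed.

Lemma ex_RInt_continuous_on (f : R -> R) a b :
  a <= b -> (forall x, a <= x <= b -> continuous f x) -> ex_RInt f a b.
Proof.
  intros Hab Hf; apply (ex_RInt_continuous (V := R_CompleteNormedModule)).
  intros z; rewrite Rmin_left, Rmax_right by lra; apply Hf.
Qed.

Lemma flux_split U V a c l m :
  0 <= l -> 0 <= m ->
  (forall x y, a <= x <= a + l -> c <= y <= c + m ->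
     continuity_2d_pt U x y /\ continuity_2d_pt V x y) ->
  flux U V a c l m =
  flux U V a c (l / 2) (m / 2) + flux U V (a + l / 2) c (l / 2) (m / 2) +
  flux U V a (c + m / 2) (l / 2) (m / 2) +
  flux U V (a + l / 2) (c + m / 2) (l / 2) (m / 2).
Proof.
  intros Hl Hm HC; unfold flux.
  replace (a + l / 2 + l / 2) with (a + l) by field.
  replace (c + m / 2 + m / 2) with (c + m) by field.
  assert (EV : forall y y' x0 x1, c <= y <= c + m -> c <= y' <= c + m ->
    a <= x0 -> x0 <= x1 -> x1 <= a + l ->
    ex_RInt (fun x => V x y - V x y') x0 x1).
  { intros y y' x0 x1 Hy Hy' H0 H01 H1; apply ex_RInt_continuous_on; [lra|].
    intros x Hx; apply (continuous_minus (V := R_NormedModule));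
    apply continuity_2d_pt_continuous_fst, HC; lra. }
  assert (EU : forall y y' x0 x1, a <= y <= a + l -> a <= y' <= a + l ->
    c <= x0 -> x0 <= x1 -> x1 <= c + m ->
    ex_RInt (fun x => U y x - U y' x) x0 x1).
  { intros y y' x0 x1 Hy Hy' H0 H01 H1; apply ex_RInt_continuous_on; [lra|].
    intros x Hx; apply (continuous_minus (V := R_NormedModule));
    apply continuity_2d_pt_continuous_snd, HC; lra. }
  assert (SV : forall x0 x1, a <= x0 -> x0 <= x1 -> x1 <= a + l ->
    RInt (fun x => V x c - V x (c + m)) x0 x1 =
    RInt (fun x => V x c - V x (c + m / 2)) x0 x1 +
    RInt (fun x => V x (c + m / 2) - V x (c + m)) x0 x1).
  { intros x0 x1 H0 H01 H1.
    rewrite <- (RInt_plus (V := R_CompleteNormedModule)) by (apply EV; lra).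
    apply RInt_ext; intros x _; simpl; unfold plus; simpl; ring. }
  assert (SU : forall x0 x1, c <= x0 -> x0 <= x1 -> x1 <= c + m ->
    RInt (fun x => U (a + l) x - U a x) x0 x1 =
    RInt (fun x => U (a + l) x - U (a + l / 2) x) x0 x1 +
    RInt (fun x => U (a + l / 2) x - U a x) x0 x1).
  { intros x0 x1 H0 H01 H1.
    rewrite <- (RInt_plus (V := R_CompleteNormedModule)) by (apply EU; lra).
    apply RInt_ext; intros x _; simpl; unfold plus; simpl; ring. }
  rewrite <- (RInt_Chasles (V := R_CompleteNormedModule)
    (fun x => V x c - V x (c + m)) a (a + l / 2) (a + l)) by (apply EV; lra).
  rewrite <- (RInt_Chasles (V := R_CompleteNormedModule)
    (fun x => U (a + l) x - U a x) c (c + m / 2) (c + m)) by (apply EU; lra).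
  rewrite !SV, !SU by lra.
  unfold plus; simpl; ring.
Qed.

(** An affine field with U_x = V_y = A contributes A * m * l - A * m * l = 0, so
    that only the deviation of U and V from their affine parts, at most [e] in the
    differences taken across the rectangle, enters the flux. *)
Lemma flux_small U V a c l m A e :
  0 <= l -> 0 <= m ->
  (forall x y, a <= x <= a + l -> c <= y <= c + m ->
     continuity_2d_pt U x y /\ continuity_2d_pt V x y) ->
  (forall x, a <= x <= a + l -> Rabs (V x c - V x (c + m) + A * m) <= e) ->
  (forall y, c <= y <= c + m -> Rabs (U (a + l) y - U a y - A * l) <= e) ->
  Rabs (flux U V a c l m) <= e * (l + m).
Proof.
  intros Hl Hm HC HV HU; unfold flux.
  assert (EV : ex_RInt (fun x => V x c - V x (c + m)) a (a + l)).
  { apply ex_RInt_continuous_on; [lra|].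
    intros x Hx; apply (continuous_minus (V := R_NormedModule));
    apply continuity_2d_pt_continuous_fst, HC; lra. }
  assert (EU : ex_RInt (fun y => U (a + l) y - U a y) c (c + m)).
  { apply ex_RInt_continuous_on; [lra|].
    intros x Hx; apply (continuous_minus (V := R_NormedModule));
    apply continuity_2d_pt_continuous_snd, HC; lra. }
  assert (E1 : RInt (fun x => V x c - V x (c + m) + A * m) a (a + l) =
     RInt (fun x => V x c - V x (c + m)) a (a + l) + A * m * l).
  { rewrite (RInt_plus (V := R_CompleteNormedModule) (fun x => V x c - V x (c + m)) (fun _ => A * m)).
    - rewrite RInt_const; unfold plus, scal; simpl; unfold mult; simpl; ring.
    - exact EV.
    - apply ex_RInt_const. }
  assert (E2 : RInt (fun y => U (a + l) y - U a y - A * l) c (c + m) =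
     RInt (fun y => U (a + l) y - U a y) c (c + m) - A * m * l).
  { rewrite (RInt_minus (V := R_CompleteNormedModule) (fun y => U (a + l) y - U a y) (fun _ => A * l)).
    - rewrite RInt_const; unfold minus, plus, opp, scal; simpl; unfold mult; simpl; ring.
    - exact EU.
    - apply ex_RInt_const. }
  replace (_ + _) with
    (RInt (fun x => V x c - V x (c + m) + A * m) a (a + l) +
     RInt (fun y => U (a + l) y - U a y - A * l) c (c + m)) by (rewrite E1, E2; ring).
  eapply Rle_trans; [apply Rabs_triang|].
  replace (e * (l + m)) with ((a + l - a) * e + (c + m - c) * e) by ring.
  apply Rplus_le_compat; apply abs_RInt_le_const; try lra; auto.
  - apply (ex_RInt_plus (V := R_NormedModule) (fun x => V x c - V x (c + m)) (fun _ => A * m));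
     [exact EV | apply ex_RInt_const].
  - apply (ex_RInt_minus (V := R_NormedModule) (fun y => U (a + l) y - U a y) (fun _ => A * l));
     [exact EU | apply ex_RInt_const].
Qed.

(** Goursat's theorem in real form: pointwise differentiability suffices, without
    continuity of the derivatives.  The comparison quantity is (l + m)^2 because
    it is shared out exactly among the four quarters of any rectangle, whatever its
    shape. *)
Lemma divergence_free_flux_zero U V a0 c0 l0 m0 :
  0 < l0 -> 0 < m0 ->
  (forall x y, a0 <= x <= a0 + l0 -> c0 <= y <= c0 + m0 ->
     exists A B D, differentiable_pt_lim U x y A B /\ differentiable_pt_lim V x y D A) ->
  flux U V a0 c0 l0 m0 = 0.
Proof.
  intros Hl0 Hm0 HD.
  assert (HC : forall x y, a0 <= x <= a0 + l0 -> c0 <= y <= c0 + m0 ->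
     continuity_2d_pt U x y /\ continuity_2d_pt V x y).
  { intros x y Hx Hy; destruct (HD x y Hx Hy) as (A & B & D & HU & HV).
    split; apply differentiable_continuity_pt; eexists; eexists; eassumption. }
  assert (Hall : forall e, 0 < e -> Rabs (flux U V a0 c0 l0 m0) <= e * (l0 + m0) ^ 2).
  { intros e He.
    apply (quadrisection_induction (fun a c l m =>
      0 <= l -> 0 <= m -> a0 <= a -> a + l <= a0 + l0 -> c0 <= c -> c + m <= c0 + m0 ->
      Rabs (flux U V a c l m) <= e * (l + m) ^ 2) a0 c0 l0 m0); try lra.
    - intros a c l m H1 H2 H3 H4 Hl Hm Ha Hal Hc Hcm.
      rewrite flux_split; try lra; [|intros; apply HC; lra].
      assert (E1 := H1 ltac:(lra) ltac:(lra) ltac:(lra) ltac:(lra) ltac:(lra) ltac:(lra)).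
      assert (E2 := H2 ltac:(lra) ltac:(lra) ltac:(lra) ltac:(lra) ltac:(lra) ltac:(lra)).
      assert (E3 := H3 ltac:(lra) ltac:(lra) ltac:(lra) ltac:(lra) ltac:(lra) ltac:(lra)).
      assert (E4 := H4 ltac:(lra) ltac:(lra) ltac:(lra) ltac:(lra) ltac:(lra) ltac:(lra)).
      replace (e * (l + m) ^ 2) with (e * (l / 2 + m / 2) ^ 2 + e * (l / 2 + m / 2) ^ 2
         + e * (l / 2 + m / 2) ^ 2 + e * (l / 2 + m / 2) ^ 2) by field.
      do 3 (eapply Rle_trans; [apply Rabs_triang|]; apply Rplus_le_compat; [|assumption]).
      assumption.
    - intros x y.
      destruct (classic (a0 <= x <= a0 + l0 /\ c0 <= y <= c0 + m0)) as [[Hx Hy]|Hout].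
      2: { exists 1; split; [lra|]; intros; exfalso; apply Hout; lra. }
      destruct (HD x y Hx Hy) as (A & B & D & HU & HV).
      assert (He' : 0 < e / 2) by lra.
      destruct (HU (mkposreal _ He')) as [d1 Hd1].
      destruct (HV (mkposreal _ He')) as [d2 Hd2].
      cbn [pos] in Hd1, Hd2.
      exists (Rmin d1 d2); split; [apply Rmin_pos; apply cond_pos|].
      intros a c l m Hl Hm Hxa Hyc _ _ Ha Hal Hc Hcm.
      assert (Hd1' := Rmin_l d1 d2); assert (Hd2' := Rmin_r d1 d2).
      assert (Hb : forall u v, a <= u <= a + l -> c <= v <= c + m ->
        Rabs (u - x) <= l /\ Rabs (v - y) <= m).
      { intros u v Hu Hv; split; apply Rabs_le; lra. }
      assert (Hmax : forall u v, a <= u <= a + l -> c <= v <= c + m ->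
        e / 2 * Rmax (Rabs (u - x)) (Rabs (v - y)) <= e / 2 * (l + m)).
      { intros u v Hu Hv; destruct (Hb u v Hu Hv); apply Rmult_le_compat_l; [lra|].
        apply Rmax_lub; lra. }
      assert (KU : forall u v, a <= u <= a + l -> c <= v <= c + m ->
        Rabs (U u v - U x y - (A * (u - x) + B * (v - y))) <= e / 2 * (l + m)).
      { intros u v Hu Hv; destruct (Hb u v Hu Hv).
        eapply Rle_trans; [apply Hd1; lra | now apply Hmax]. }
      assert (KV : forall u v, a <= u <= a + l -> c <= v <= c + m ->
        Rabs (V u v - V x y - (D * (u - x) + A * (v - y))) <= e / 2 * (l + m)).
      { intros u v Hu Hv; destruct (Hb u v Hu Hv).
        eapply Rle_trans; [apply Hd2; lra | now apply Hmax]. }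
      replace (e * (l + m) ^ 2) with (e * (l + m) * (l + m)) by ring.
      apply flux_small with (A := A); try lra.
      + intros; apply HC; lra.
      + intros u Hu.
        assert (K1 := KV u c Hu ltac:(lra)); assert (K2 := KV u (c + m) Hu ltac:(lra)).
        apply Rabs_le; apply Rabs_le_between in K1; apply Rabs_le_between in K2; lra.
      + intros v Hv.
        assert (K1 := KU a v ltac:(lra) Hv); assert (K2 := KU (a + l) v ltac:(lra) Hv).
        apply Rabs_le; apply Rabs_le_between in K1; apply Rabs_le_between in K2; lra. }
  apply NNPP; intros Hne.
  assert (Hpos : 0 < Rabs (flux U V a0 c0 l0 m0)) by now apply Rabs_pos_lt.
  assert (HL : 0 < (l0 + m0) ^ 2) by (apply pow_lt; lra).
  specialize (Hall (Rabs (flux U V a0 c0 l0 m0) / (2 * (l0 + m0) ^ 2))).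
  assert (He : 0 < Rabs (flux U V a0 c0 l0 m0) / (2 * (l0 + m0) ^ 2))
    by (apply Rdiv_lt_0_compat; lra).
  specialize (Hall He).
  replace (Rabs (flux U V a0 c0 l0 m0) / (2 * (l0 + m0) ^ 2) * (l0 + m0) ^ 2) with
    (Rabs (flux U V a0 c0 l0 m0) / 2) in Hall by (field; lra).
  lra.
Qed.

(** * Complex differentiability *)

(** Continuity and complex differentiability are spelled out with [Cmod], because
    the two uniform structures on C (product distance and modulus) have different
    balls. *)
Definition ccont (f : C -> C) (z : C) : Prop :=
  forall eps, 0 < eps -> exists del, 0 < del /\
    forall w, Cmod (w - z) < del -> Cmod (f w - f z) < eps.

Definition is_cderiv (f : C -> C) (z d : C) : Prop :=
  forall eps, 0 < eps -> exists del, 0 < del /\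
    forall w, Cmod (w - z) < del ->
      Cmod (f w - f z - d * (w - z)) <= eps * Cmod (w - z).

Definition cdiff (f : C -> C) (z : C) : Prop := exists d, is_cderiv f z d.

Lemma Cmod_sub_comm a b : Cmod (a - b) = Cmod (b - a).
Proof. rewrite <- Cmod_opp; f_equal; ring. Qed.

Lemma Cmod_triangle_sub a b : Cmod (a - b) <= Cmod a + Cmod b.
Proof. rewrite <- (Cmod_opp b); apply Cmod_triangle. Qed.

Lemma Cmod_triangle_inv a b : Cmod a - Cmod b <= Cmod (a - b).
Proof.
  assert (H := Cmod_triangle (a - b) b).
  replace (a - b + b)%C with a in H by ring; lra.
Qed.

Lemma Cmod_zero_sub a : Cmod (a - a) = 0.
Proof. replace (a - a)%C with (RtoC 0) by ring; apply Cmod_0. Qed.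

Lemma ccont_const c z : ccont (fun _ => c) z.
Proof.
  intros e He; exists 1; split; [lra|]; intros w _; rewrite Cmod_zero_sub; lra.
Qed.

Lemma ccont_id z : ccont (fun w => w) z.
Proof. intros e He; exists e; split; auto. Qed.

Lemma ccont_plus f g z : ccont f z -> ccont g z -> ccont (fun w => f w + g w)%C z.
Proof.
  intros Hf Hg e He.
  destruct (Hf (e / 2) ltac:(lra)) as [d1 [Hd1 K1]].
  destruct (Hg (e / 2) ltac:(lra)) as [d2 [Hd2 K2]].
  exists (Rmin d1 d2); split; [now apply Rmin_pos|]; intros w Hw.
  assert (A1 := Rmin_l d1 d2); assert (A2 := Rmin_r d1 d2).
  replace (f w + g w - (f z + g z))%C with ((f w - f z) + (g w - g z))%C by ring.
  eapply Rle_lt_trans; [apply Cmod_triangle|].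
  specialize (K1 w ltac:(lra)); specialize (K2 w ltac:(lra)); lra.
Qed.

Lemma ccont_mult f g z : ccont f z -> ccont g z -> ccont (fun w => f w * g w)%C z.
Proof.
  intros Hf Hg e He.
  pose (M := Cmod (f z) + Cmod (g z) + 1).
  assert (P1 := Cmod_ge_0 (f z)); assert (P2 := Cmod_ge_0 (g z)).
  assert (HM : 0 < M) by (unfold M; lra).
  pose (k := Rmin 1 (e / (2 * M))).
  assert (Hk : 0 < k).
  { apply Rmin_pos; [lra | apply Rdiv_lt_0_compat; lra]. }
  assert (Hk1 : k <= 1) by apply Rmin_l.
  assert (Hk2 : k * M <= e / 2).
  { apply Rle_trans with (e / (2 * M) * M).
    - apply Rmult_le_compat_r; [lra | apply Rmin_r].
    - right; field; lra. }
  destruct (Hf k Hk) as [d1 [Hd1 K1]].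
  destruct (Hg k Hk) as [d2 [Hd2 K2]].
  exists (Rmin d1 d2); split; [now apply Rmin_pos|]; intros w Hw.
  assert (A1 := Rmin_l d1 d2); assert (A2 := Rmin_r d1 d2).
  replace (f w * g w - f z * g z)%C with
    ((f w - f z) * (g w - g z) + (f w - f z) * g z + f z * (g w - g z))%C by ring.
  eapply Rle_lt_trans; [apply Cmod_triangle|].
  eapply Rle_lt_trans; [apply Rplus_le_compat_r, Cmod_triangle|].
  rewrite !Cmod_mult.
  specialize (K1 w ltac:(lra)); specialize (K2 w ltac:(lra)).
  assert (Q1 := Cmod_ge_0 (f w - f z)); assert (Q2 := Cmod_ge_0 (g w - g z)).
  assert (Cmod (f w - f z) * Cmod (g w - g z) <= k * 1) by (apply Rmult_le_compat; lra).
  assert (Cmod (f w - f z) * Cmod (g z) <= k * Cmod (g z)) by (apply Rmult_le_compat_r; lra).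
  assert (Cmod (f z) * Cmod (g w - g z) <= Cmod (f z) * k) by (apply Rmult_le_compat_l; lra).
  unfold M in Hk2; nra.
Qed.

Lemma ccont_inv f z : ccont f z -> f z <> 0 -> ccont (fun w => / f w)%C z.
Proof.
  intros Hf Hz e He.
  pose (m := Cmod (f z)).
  assert (Hm : 0 < m) by now apply Cmod_gt_0.
  assert (Hmm : 0 < m * m) by nra.
  assert (He' : 0 < e * (m * m) / 2) by nra.
  assert (Hk : 0 < Rmin (m / 2) (e * (m * m) / 2)) by (apply Rmin_pos; lra).
  destruct (Hf _ Hk) as [d [Hd K]].
  exists d; split; [exact Hd|]; intros w Hw; specialize (K w Hw).
  assert (A1 := Rmin_l (m / 2) (e * (m * m) / 2)).
  assert (A2 := Rmin_r (m / 2) (e * (m * m) / 2)).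
  assert (B := Cmod_triangle_inv (f z) (f w)).
  rewrite Cmod_sub_comm in B; fold m in B.
  assert (Hw2 : m / 2 < Cmod (f w)) by lra.
  assert (Hwn : f w <> 0) by (apply Cmod_gt_0; lra).
  replace (/ f w - / f z)%C with (- (f w - f z) / (f w * f z))%C by (field; auto).
  rewrite Cmod_div by (now apply Cmult_neq_0).
  rewrite Cmod_opp, Cmod_mult; fold m.
  apply Rmult_lt_reg_r with (Cmod (f w) * m); [nra|].
  unfold Rdiv; rewrite Rmult_assoc, Rinv_l by nra.
  nra.
Qed.

(** Caratheodory's form of the derivative reduces the rules of calculus to
    continuity of sums, products and inverses. *)
Lemma cderiv_caratheodory f z d :
  is_cderiv f z d <->
  exists phi, ccont phi z /\ phi z = d /\ forall w, f w = (f z + phi w * (w - z))%C.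
Proof.
  split.
  - intros Hd.
    exists (fun w => if Ceq_dec w z then d else (f w - f z) / (w - z))%C.
    split; [|split].
    + intros e He; destruct (Hd (e / 2) ltac:(lra)) as [del [Hdel K]].
      exists del; split; [exact Hdel|]; intros w Hw.
      destruct (Ceq_dec z z) as [_|]; [|tauto].
      destruct (Ceq_dec w z) as [->|Hne]; [rewrite Cmod_zero_sub; lra|].
      assert (Hn : (w - z)%C <> 0) by now apply Cminus_eq_contra.
      assert (Hp : 0 < Cmod (w - z)) by now apply Cmod_gt_0.
      replace ((f w - f z) / (w - z) - d)%C with
        ((f w - f z - d * (w - z)) / (w - z))%C by (now field).
      rewrite Cmod_div by exact Hn.
      apply Rle_lt_trans with (e / 2); [|lra].
      apply Rmult_le_reg_r with (Cmod (w - z)); [exact Hp|].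
      unfold Rdiv at 1; rewrite Rmult_assoc, Rinv_l, Rmult_1_r by lra.
      now apply K.
    + destruct (Ceq_dec z z); tauto.
    + intros w; destruct (Ceq_dec w z) as [->|Hne]; [ring|].
      field; now apply Cminus_eq_contra.
  - intros (phi & Hc & <- & Hf) e He.
    destruct (Hc e He) as [del [Hdel K]].
    exists del; split; [exact Hdel|]; intros w Hw; rewrite (Hf w).
    replace (f z + phi w * (w - z) - f z - phi z * (w - z))%C with
      ((phi w - phi z) * (w - z))%C by ring.
    rewrite Cmod_mult; apply Rmult_le_compat_r; [apply Cmod_ge_0|].
    left; now apply K.
Qed.

Lemma ccont_ext f g z : (forall w, f w = g w) -> ccont f z -> ccont g z.
Proof. intros E H e He; destruct (H e He) as [d [Hd K]]; exists d; split; auto;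
  intros w Hw; rewrite <- !E; auto. Qed.

Lemma cdiff_ccont f z : cdiff f z -> ccont f z.
Proof.
  intros [d Hd]; apply cderiv_caratheodory in Hd; destruct Hd as (phi & Hc & _ & Hf).
  apply ccont_ext with (fun w => f z + phi w * (w + - z))%C; [symmetry; apply Hf|].
  apply ccont_plus; [apply ccont_const|].
  apply ccont_mult; [exact Hc|apply ccont_plus; [apply ccont_id | apply ccont_const]].
Qed.

Lemma cdiff_const c z : cdiff (fun _ => c) z.
Proof.
  exists (RtoC 0); apply cderiv_caratheodory; exists (fun _ => RtoC 0).
  split; [apply ccont_const|split; [reflexivity|intros; ring]].
Qed.

Lemma cdiff_id z : cdiff (fun w => w) z.
Proof.
  exists (RtoC 1); apply cderiv_caratheodory; exists (fun _ => RtoC 1).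
  split; [apply ccont_const|split; [reflexivity|intros; ring]].
Qed.

Lemma cdiff_plus f g z : cdiff f z -> cdiff g z -> cdiff (fun w => f w + g w)%C z.
Proof.
  intros [d Hd] [d' Hd']; apply cderiv_caratheodory in Hd, Hd'.
  destruct Hd as (phi & Hc & _ & Hf), Hd' as (psi & Hc' & _ & Hg).
  exists (phi z + psi z)%C; apply cderiv_caratheodory.
  exists (fun w => phi w + psi w)%C; split; [now apply ccont_plus|split; [reflexivity|]].
  intros w; rewrite (Hf w), (Hg w); ring.
Qed.

Lemma cdiff_mult f g z : cdiff f z -> cdiff g z -> cdiff (fun w => f w * g w)%C z.
Proof.
  intros Df Dg; pose proof (cdiff_ccont _ _ Df) as Cf.
  destruct Df as [d Hd], Dg as [d' Hd']; apply cderiv_caratheodory in Hd, Hd'.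
  destruct Hd as (phi & Hc & _ & Hf), Hd' as (psi & Hc' & _ & Hg).
  eexists; apply cderiv_caratheodory.
  exists (fun w => phi w * g z + f w * psi w)%C; split; [|split; [reflexivity|]].
  - apply ccont_plus; apply ccont_mult; auto; apply ccont_const.
  - intros w; rewrite (Hg w), (Hf w); ring.
Qed.

Lemma cdiff_loc f g z :
  (exists del, 0 < del /\ forall w, Cmod (w - z) < del -> f w = g w) ->
  cdiff f z -> cdiff g z.
Proof.
  intros (del & Hdel & E) [d Hd]; exists d; intros e He.
  destruct (Hd e He) as [del' [Hdel' K]].
  exists (Rmin del del'); split; [now apply Rmin_pos|]; intros w Hw.
  assert (A1 := Rmin_l del del'); assert (A2 := Rmin_r del del').
  rewrite <- (E w), <- (E z); [apply K; lra | rewrite Cmod_zero_sub; lra | lra].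
Qed.

Lemma cdiff_inv f z : cdiff f z -> f z <> 0 -> cdiff (fun w => / f w)%C z.
Proof.
  intros Df Hz; pose proof (cdiff_ccont _ _ Df) as Cf.
  destruct Df as [d Hd]; apply cderiv_caratheodory in Hd.
  destruct Hd as (phi & Hc & _ & Hf).
  assert (Hm : 0 < Cmod (f z)) by now apply Cmod_gt_0.
  destruct (Cf (Cmod (f z)) Hm) as [del [Hdel Hnz]].
  assert (Hnz' : forall w, Cmod (w - z) < del -> f w <> 0).
  { intros w Hw E; specialize (Hnz w Hw); rewrite E, Cmod_sub_comm in Hnz.
    replace (f z - 0)%C with (f z) in Hnz by ring; lra. }
  apply cdiff_loc with (fun w => / f z + (- phi w / (f w * f z)) * (w - z))%C.
  { exists del; split; [exact Hdel|]; intros w Hw.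
    assert (Hfw := Hnz' w Hw).
    assert (Ew : (f w - f z)%C = (phi w * (w - z))%C) by (rewrite (Hf w); ring).
    transitivity (/ f z + - (phi w * (w - z)) / (f w * f z))%C; [field; auto|].
    rewrite <- Ew; field; auto. }
  eexists; apply cderiv_caratheodory.
  exists (fun w => - phi w / (f w * f z))%C; split; [|split; [reflexivity|]].
  - apply ccont_ext with (fun w => ((- RtoC 1) * phi w) * / (f w * f z))%C.
    { intros w; unfold Cdiv; ring. }
    apply ccont_mult; [apply ccont_mult; [apply ccont_const|exact Hc]|].
    apply ccont_inv; [apply ccont_mult; [exact Cf|apply ccont_const]|].
    now apply Cmult_neq_0.
  - intros w; ring.
Qed.

Lemma cdiff_div f g z :
  cdiff f z -> cdiff g z -> g z <> 0 -> cdiff (fun w => f w / g w)%C z.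
Proof. intros; apply cdiff_mult; [assumption | now apply cdiff_inv]. Qed.

Lemma cdiff_minus f g z : cdiff f z -> cdiff g z -> cdiff (fun w => f w - g w)%C z.
Proof.
  intros Df Dg; apply cdiff_loc with (fun w => f w + (- RtoC 1) * g w)%C.
  - exists 1; split; [lra|]; intros w _; ring.
  - apply cdiff_plus, cdiff_mult; auto; apply cdiff_const.
Qed.

Lemma cdiff_comp_scal f (s z : C) : cdiff f (s * z)%C -> cdiff (fun w => f (s * w)%C) z.
Proof.
  intros [d Hd]; exists (d * s)%C; intros e He.
  assert (Hs := Cmod_ge_0 s).
  destruct (Hd (e / (Cmod s + 1))) as [del [Hdel K]].
  { apply Rdiv_lt_0_compat; lra. }
  exists (del / (Cmod s + 1)); split; [apply Rdiv_lt_0_compat; lra|]; intros w Hw.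
  assert (Hw0 := Cmod_ge_0 (w - z)).
  assert (E : Cmod (s * w - s * z) = Cmod s * Cmod (w - z)).
  { rewrite <- Cmod_mult; f_equal; ring. }
  assert (Hlt : Cmod s * Cmod (w - z) < del).
  { apply Rmult_lt_compat_r with (r := Cmod s + 1) in Hw; [|lra].
    unfold Rdiv in Hw; rewrite Rmult_assoc, Rinv_l in Hw by lra; nra. }
  specialize (K (s * w)%C ltac:(rewrite E; exact Hlt)).
  rewrite E in K.
  replace (f (s * w) - f (s * z) - d * s * (w - z))%C with
     (f (s * w) - f (s * z) - d * (s * w - s * z))%C by ring.
  eapply Rle_trans; [exact K|].
  apply Rmult_le_reg_r with (Cmod s + 1); [lra|].
  replace (e / (Cmod s + 1) * (Cmod s * Cmod (w - z)) * (Cmod s + 1)) with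
    (e * Cmod s * Cmod (w - z)) by (field; lra).
  nra.
Qed.

Lemma cderiv_is_derive f z d :
  is_cderiv f z d <-> @is_derive C_AbsRing C_NormedModule f z d.
Proof.
  split.
  - intros Hd; split; [apply is_linear_scal_l|].
    intros x Hx e.
    assert (Ex : x = z).
    { symmetry; apply (is_filter_lim_locally_unique (V := AbsRing_NormedModule C_AbsRing)).
      exact Hx. }
    subst x.
    destruct (Hd e (cond_pos e)) as [del [Hdel K]].
    exists (mkposreal del Hdel); intros w Hw.
    specialize (K w Hw).
    change (Cmod (f w - f z - (w - z) * d)%C <= e * Cmod (w - z)%C).
    now rewrite (Cmult_comm (w - z) d).
  - intros [_ H] e He.
    destruct (H z (fun P HP => HP) (mkposreal e He)) as [del K].
    exists del; split; [apply cond_pos|]; intros w Hw.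
    specialize (K w Hw).
    change (Cmod (f w - f z - (w - z) * d)%C <= e * Cmod (w - z)%C) in K.
    now rewrite (Cmult_comm d (w - z)).
Qed.

Lemma holomorphic_iff f :
  holomorphic_on_disc f <-> forall z, unit_disc z -> cdiff f z.
Proof.
  split; intros H z Hz; destruct (H z Hz) as [d Hd]; exists d; now apply cderiv_is_derive.
Qed.

(** * The mean value property *)

Lemma Cmod_le_max z : Cmod z <= 2 * Rmax (Rabs (Re z)) (Rabs (Im z)).
Proof.
  eapply Rle_trans; [apply Cmod_2Rmax|]; apply Rmult_le_compat_r.
  - eapply Rle_trans; [apply Rabs_pos | apply Rmax_l].
  - apply Rsqr_incr_0_var; [|lra]; rewrite Rsqr_sqrt; unfold Rsqr; lra.
Qed.

Lemma im_le_Cmod z : Rabs (Im z) <= Cmod z.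
Proof. eapply Rle_trans; [apply Rmax_r | apply Rmax_Cmod]. Qed.

(** The next two lemmas are the Cauchy-Riemann equations: the x-derivative of the
    real part equals the y-derivative of the imaginary part. *)
Lemma cderiv_Re f z d :
  is_cderiv f z d ->
  differentiable_pt_lim (fun x y => Re (f (x, y))) (Re z) (Im z) (Re d) (- Im d).
Proof.
  intros H e.
  destruct (H (e / 2)) as [del [Hdel K]]; [apply is_pos_div_2|].
  assert (Hdel2 : 0 < del / 2) by lra.
  exists (mkposreal _ Hdel2); cbn [pos]; intros u v Hu Hv.
  assert (Hm : Cmod ((u, v) - z) <= 2 * Rmax (Rabs (u - Re z)) (Rabs (v - Im z)))
    by apply (Cmod_le_max ((u, v) - z)%C).
  assert (Hlt : Cmod ((u, v) - z) < del).
  { eapply Rle_lt_trans; [exact Hm|].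
    assert (Rmax (Rabs (u - Re z)) (Rabs (v - Im z)) < del / 2) by (apply Rmax_lub_lt; auto).
    lra. }
  specialize (K _ Hlt).
  replace (Re z, Im z) with z by (destruct z; reflexivity).
  replace (_ - _ - _) with (Re (f (u, v) - f z - d * ((u, v) - z))%C)
    by (unfold Cminus, Cplus, Copp, Cmult, Re, Im; simpl; ring).
  eapply Rle_trans; [apply re_le_Cmod|].
  eapply Rle_trans; [exact K|].
  apply Rle_trans with (e / 2 * (2 * Rmax (Rabs (u - Re z)) (Rabs (v - Im z)))).
  - apply Rmult_le_compat_l; [apply Rlt_le, is_pos_div_2 | exact Hm].
  - right; field.
Qed.

Lemma cderiv_scal f z d c : is_cderiv f z d -> is_cderiv (fun w => c * f w)%C z (c * d).
Proof.
  intros H; apply cderiv_caratheodory in H; destruct H as (phi & Hc & <- & Hf).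
  apply cderiv_caratheodory; exists (fun w => c * phi w)%C; split; [|split; [reflexivity|]].
  - apply ccont_mult; [apply ccont_const | exact Hc].
  - intros w; rewrite (Hf w); ring.
Qed.

Lemma cderiv_Im f z d :
  is_cderiv f z d ->
  differentiable_pt_lim (fun x y => Im (f (x, y))) (Re z) (Im z) (Im d) (Re d).
Proof.
  intros H; apply (cderiv_scal _ _ _ (- Ci)%C), cderiv_Re in H.
  replace (Re (- Ci * d)) with (Im d) in H by (unfold Re, Im; simpl; ring).
  replace (- Im (- Ci * d)) with (Re d) in H by (unfold Re, Im; simpl; ring).
  revert H; apply differentiable_pt_lim_ext.
  exists (mkposreal 1 Rlt_0_1); intros; unfold Re, Im; simpl; ring.
Qed.

Lemma differentiable_proj2 (f : R -> R) x y l :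
  derivable_pt_lim f y l -> differentiable_pt_lim (fun _ v => f v) x y 0 l.
Proof.
  intros H; apply (differentiable_pt_lim_proj1_0 f y x l) in H; intros e.
  destruct (H e) as [d K]; exists d; intros u v Hu Hv.
  specialize (K v u Hv Hu).
  rewrite Rmax_comm.
  replace (0 * (u - x) + l * (v - y)) with (l * (v - y) + 0 * (u - x)) by ring.
  exact K.
Qed.

Lemma differentiable_mult x y : differentiable_pt_lim (fun u v => u * v) x y y x.
Proof.
  intros e; exists e; intros u v Hu Hv.
  replace (u * v - x * y - (y * (u - x) + x * (v - y))) with ((u - x) * (v - y)) by ring.
  rewrite Rabs_mult.
  apply Rmult_le_compat; try apply Rabs_pos; [lra | apply Rmax_r].
Qed.

Lemma differentiable_mult_sep f g x y f' g' :
  derivable_pt_lim f x f' -> derivable_pt_lim g y g' ->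
  differentiable_pt_lim (fun u v => f u * g v) x y (f' * g y) (f x * g').
Proof.
  intros Hf Hg.
  assert (H := differentiable_pt_lim_comp (fun u v => u * v) (fun u _ => f u) (fun _ v => g v)
    x y _ _ _ _ _ _ (differentiable_mult (f x) (g y))
    (differentiable_pt_lim_proj1_0 f x y f' Hf) (differentiable_proj2 g x y g' Hg)).
  intros e; destruct (H e) as [d K]; exists d; intros u v Hu Hv.
  specialize (K u v Hu Hv).
  replace (f' * g y * (u - x) + f x * g' * (v - y)) with
    ((g y * f' + f x * 0) * (u - x) + (g y * 0 + f x * g') * (v - y)) by ring.
  exact K.
Qed.

Definition polar (r t : R) : C := (r * cos t, r * sin t).

Lemma Cmod_polar r t : 0 <= r -> Cmod (polar r t) = r.
Proof.
  intros Hr; unfold Cmod, polar; simpl.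
  replace (_ + _) with (r * r * (Rsqr (sin t) + Rsqr (cos t))) by (unfold Rsqr; ring).
  rewrite sin2_cos2, Rmult_1_r; now apply sqrt_square.
Qed.

(** Logarithmic polar coordinates (s, t), for the point exp (s + i t), are
    conformal; the equation U_s = V_t needed for the vanishing of the flux thus
    holds in them, while in the coordinates (r, t) it would not. *)
Lemma polar_differentiable f s t d :
  is_cderiv f (polar (exp s) t) d ->
  exists A B D,
    differentiable_pt_lim (fun s t => Re (f (polar (exp s) t))) s t A B /\
    differentiable_pt_lim (fun s t => Im (f (polar (exp s) t))) s t D A.
Proof.
  intros H.
  assert (Hx := differentiable_mult_sep exp cos s t _ _
    (derivable_pt_lim_exp s) (derivable_pt_lim_cos t)).
  assert (Hy := differentiable_mult_sep exp sin s t _ _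
    (derivable_pt_lim_exp s) (derivable_pt_lim_sin t)).
  assert (HU := differentiable_pt_lim_comp _ _ _ s t _ _ _ _ _ _ (cderiv_Re _ _ _ H) Hx Hy).
  assert (HV := differentiable_pt_lim_comp _ _ _ s t _ _ _ _ _ _ (cderiv_Im _ _ _ H) Hx Hy).
  eexists; eexists; eexists; split; [exact HU|].
  match type of HV with differentiable_pt_lim _ _ _ ?D ?A =>
  match type of HU with differentiable_pt_lim _ _ _ ?A' _ =>
    replace A' with A by ring end end.
  exact HV.
Qed.

Lemma cdiff_shift f z0 z : cdiff f (z0 + z)%C -> cdiff (fun w => f (z0 + w)%C) z.
Proof.
  intros [d Hd]; exists d; intros e He; destruct (Hd e He) as [del [Hdel K]].
  exists del; split; [exact Hdel|]; intros w Hw.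
  replace (w - z)%C with (z0 + w - (z0 + z))%C in * by ring.
  now apply K.
Qed.

(** In logarithmic polar coordinates around [z0] the horizontal sides of the
    rectangle [s, ln rho] x [0, 2 PI] cancel by periodicity, so the integrals over
    the circles of radii exp s and rho agree; let s tend to minus infinity.  The
    centre is never reached: continuity is enough there, and this is what makes a
    removable singularity harmless below. *)
Lemma mean_value_circle G z0 rho :
  0 < rho -> ccont G z0 ->
  (forall w, 0 < Cmod (w - z0) <= rho -> cdiff G w) ->
  is_RInt (fun t => Re (G (z0 + polar rho t)%C)) 0 (2 * PI) (2 * PI * Re (G z0)).
Proof.
  intros Hrho Hc HG.
  pose (U := fun s t => Re (G (z0 + polar (exp s) t)%C)).
  pose (V := fun s t => Im (G (z0 + polar (exp s) t)%C)).
  assert (HPI := PI_RGT_0).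
  assert (HD : forall s t, s <= ln rho -> exists A B D,
    differentiable_pt_lim U s t A B /\ differentiable_pt_lim V s t D A).
  { intros s t Hs.
    assert (Hes : exp s <= rho).
    { rewrite <- (exp_ln rho) by exact Hrho.
      destruct Hs as [Hs | ->]; [left; now apply exp_increasing | now right]. }
    destruct (cdiff_shift G z0 (polar (exp s) t)) as [d Hd].
    - apply HG.
      replace (z0 + polar (exp s) t - z0)%C with (polar (exp s) t) by ring.
      rewrite Cmod_polar by (left; apply exp_pos); split; [apply exp_pos | exact Hes].
    - exact (polar_differentiable _ s t d Hd). }
  assert (HCU : forall s t, s <= ln rho -> continuity_2d_pt U s t).
  { intros s t Hs; destruct (HD s t Hs) as (A & B & D & HU & _).
    apply differentiable_continuity_pt; eexists; eexists; eassumption. }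
  assert (HI : forall s, s <= ln rho -> ex_RInt (U s) 0 (2 * PI)).
  { intros s Hs; apply ex_RInt_continuous_on; [lra|]; intros t _.
    now apply continuity_2d_pt_continuous_snd, HCU. }
  assert (Hflux : forall s, s < ln rho -> RInt (U (ln rho)) 0 (2 * PI) = RInt (U s) 0 (2 * PI)).
  { intros s Hs.
    assert (F : flux U V s 0 (ln rho - s) (2 * PI) = 0).
    { apply divergence_free_flux_zero; try lra; intros x y Hx _; apply HD; lra. }
    unfold flux in F.
    replace (s + (ln rho - s)) with (ln rho) in F by ring.
    rewrite Rplus_0_l in F.
    rewrite (RInt_ext (fun x => V x 0 - V x (2 * PI)) (fun _ => 0)) in F.
    2: { intros x _; unfold V, polar; rewrite cos_2PI, sin_2PI, cos_0, sin_0; apply Rminus_eq_0. }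
    rewrite RInt_const in F.
    rewrite (RInt_minus (V := R_CompleteNormedModule) (U (ln rho)) (U s)) in F
      by (apply HI; lra).
    unfold scal, minus, plus, opp in F; simpl in F; unfold mult in F; simpl in F; lra. }
  assert (Hlim : forall e, 0 < e ->
    Rabs (RInt (U (ln rho)) 0 (2 * PI) - 2 * PI * Re (G z0)) <= (2 * PI - 0) * e).
  { intros e He; destruct (Hc e He) as [del [Hdel K]].
    (* A circle small enough for the continuity bound at the centre. *)
    pose (s := Rmin (ln rho - 1) (ln (del / 2))).
    assert (Hs1 : s <= ln rho - 1) by apply Rmin_l.
    assert (Hs2 : s <= ln (del / 2)) by apply Rmin_r.
    assert (Hes : exp s < del).
    { apply Rle_lt_trans with (del / 2); [|lra].
      rewrite <- (exp_ln (del / 2)) by lra.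
      destruct Hs2 as [Hs2 | ->]; [left; now apply exp_increasing | now right]. }
    rewrite (Hflux s) by lra.
    replace (RInt (U s) 0 (2 * PI) - 2 * PI * Re (G z0)) with
       (RInt (fun t => U s t - Re (G z0)) 0 (2 * PI)).
    2: { rewrite (RInt_minus (V := R_CompleteNormedModule) (U s) (fun _ => Re (G z0))).
         - rewrite RInt_const; unfold minus, plus, opp, scal; simpl; unfold mult; simpl; ring.
         - apply HI; lra.
         - apply ex_RInt_const. }
    apply abs_RInt_le_const; [lra| |].
    - apply (ex_RInt_minus (V := R_NormedModule) (U s) (fun _ => Re (G z0)));
        [apply HI; lra | apply ex_RInt_const].
    - intros t _; unfold U.
      replace (Re (G (z0 + polar (exp s) t)%C) - Re (G z0)) with
        (Re (G (z0 + polar (exp s) t) - G z0)%C) by (unfold Re; simpl; ring).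
      eapply Rle_trans; [apply re_le_Cmod|]; left; apply K.
      replace (z0 + polar (exp s) t - z0)%C with (polar (exp s) t) by ring.
      rewrite Cmod_polar; [exact Hes | left; apply exp_pos]. }
  assert (E : RInt (U (ln rho)) 0 (2 * PI) = 2 * PI * Re (G z0)).
  { apply NNPP; intros Hne.
    assert (Hp : 0 < Rabs (RInt (U (ln rho)) 0 (2 * PI) - 2 * PI * Re (G z0)))
      by (apply Rabs_pos_lt; lra).
    set (x := Rabs _) in *.
    assert (Hx : 0 < x / (4 * PI)) by (apply Rdiv_lt_0_compat; lra).
    specialize (Hlim _ Hx).
    replace ((2 * PI - 0) * (x / (4 * PI))) with (x / 2) in Hlim by (field; lra).
    lra. }
  rewrite <- E.
  apply is_RInt_ext with (U (ln rho)).
  - intros t _; unfold U; now rewrite exp_ln.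
  - apply (RInt_correct (V := R_CompleteNormedModule)), HI; lra.
Qed.

Lemma circle_bound G z0 rho c :
  0 < rho -> ccont G z0 ->
  (forall w, 0 < Cmod (w - z0) <= rho -> cdiff G w) ->
  (forall w, Cmod (w - z0) = rho -> Re (G w) <= c) -> Re (G z0) <= c.
Proof.
  intros Hrho Hc HG Hb; assert (HPI := PI_RGT_0).
  assert (H := mean_value_circle G z0 rho Hrho Hc HG).
  assert (L : 2 * PI * Re (G z0) <= (2 * PI - 0) * c).
  { apply (is_RInt_le (fun t => Re (G (z0 + polar rho t)%C)) (fun _ => c) 0 (2 * PI)).
    - lra.
    - exact H.
    - apply (is_RInt_const (V := R_NormedModule)).
    - intros t _; apply Hb.
      replace (z0 + polar rho t - z0)%C with (polar rho t) by ring.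
      apply Cmod_polar; lra. }
  nra.
Qed.

(** * The maximum principle on a disc *)

(** Compactness of the closed disc: a positive function [delta] need not be bounded
    below, but every point of the disc is within [delta u] of some [u] at which it
    is at least [d].  A modulus of continuity and a bound can both be read off from
    such [u]. *)
Lemma disc_lebesgue_number r (delta : C -> R) :
  (forall u, Cmod u <= r -> 0 < delta u) ->
  exists d, 0 < d /\ forall z, Cmod z <= r ->
    exists u, Cmod u <= r /\ Cmod (z - u) < delta u /\ d <= delta u.
Proof.
  intros Hpos.
  assert (H : exists D : R * R -> posreal, forall u,
    (Cmod u <= r -> pos (D u) = delta u / 2) /\ (r < Cmod u -> pos (D u) = (Cmod u - r) / 2)).
  { apply choice_function with (R := fun u (x : posreal) =>
    (Cmod u <= r -> pos x = delta u / 2) /\ (r < Cmod u -> pos x = (Cmod u - r) / 2)).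
    intros u; destruct (Rle_lt_dec (Cmod u) r) as [Hu|Hu].
    - assert (P : 0 < delta u / 2) by (specialize (Hpos u Hu); lra).
      exists (mkposreal _ P); split; intros; [reflexivity | lra].
    - assert (P : 0 < (Cmod u - r) / 2) by lra.
      exists (mkposreal _ P); split; intros; [lra | reflexivity]. }
  destruct H as [D HD].
  destruct (compactness_value_2d (- r) r (- r) r (fun x y => D (x, y))) as [d Hd].
  exists d; split; [apply cond_pos|]; intros z Hz.
  assert (Hre := Rabs_le_between (Re z) r); assert (Him := Rabs_le_between (Im z) r).
  assert (H1 := re_le_Cmod z); assert (H2 := im_le_Cmod z).
  apply NNPP; intros Hno.
  apply (Hd (Re z) (Im z)); [apply Hre; lra | apply Him; lra|].
  intros (u & v & _ & _ & Hu & Hv & Hdd); apply Hno; exists (u, v).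
  assert (Hclose : Cmod (z - (u, v)) < 2 * D (u, v)).
  { eapply Rle_lt_trans; [apply Cmod_le_max|].
    apply Rmult_lt_compat_l; [lra|]; now apply Rmax_lub_lt. }
  assert (Htri := Cmod_triangle_inv (u, v) z); rewrite Cmod_sub_comm in Htri.
  destruct (HD (u, v)) as [K1 K2].
  destruct (Rle_lt_dec (Cmod (u, v)) r) as [Huv|Huv].
  - specialize (K1 Huv); specialize (Hpos _ Huv); split; [exact Huv|split; lra].
  - specialize (K2 Huv); lra.
Qed.

(** If the supremum S were not attained, one could take [delta u] at most
    (S - v u) / 2 and such that v stays below S - delta u near u, and so below
    S - d on the whole disc. *)
Lemma disc_maximum r (v : C -> R) :
  0 <= r ->
  (forall z, Cmod z <= r -> forall e, 0 < e -> exists del, 0 < del /\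
     forall w, Cmod (w - z) < del -> Rabs (v w - v z) < e) ->
  exists z0, Cmod z0 <= r /\ forall z, Cmod z <= r -> v z <= v z0.
Proof.
  intros Hr Hv.
  assert (Hdelta : forall e : C -> R, (forall u, 0 < e u) -> exists delta : C -> R,
    forall u, Cmod u <= r -> 0 < delta u <= e u /\
      forall w, Cmod (w - u) < delta u -> Rabs (v w - v u) < e u).
  { intros e He; apply choice_function with (R := fun u d =>
       Cmod u <= r -> 0 < d <= e u /\
       forall w, Cmod (w - u) < d -> Rabs (v w - v u) < e u).
    intros u; destruct (Rle_lt_dec (Cmod u) r) as [Hu|Hu]; [|exists 0; lra].
    destruct (Hv u Hu (e u) (He u)) as [del [Hdel K]].
    exists (Rmin del (e u)); intros _; split.
    - split; [now apply Rmin_pos | apply Rmin_r].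
    - intros w Hw; apply K; eapply Rlt_le_trans; [exact Hw | apply Rmin_l]. }
  assert (Hub : exists B, forall z, Cmod z <= r -> v z <= B).
  { destruct (Hdelta (fun u => / (Rabs (v u) + 1))) as [delta K].
    { intros u; apply Rinv_0_lt_compat; assert (H := Rabs_pos (v u)); lra. }
    destruct (disc_lebesgue_number r delta) as (d & Hd & Hcov).
    { intros u Hu; now apply K. }
    exists (/ d + 1); intros z Hz.
    destruct (Hcov z Hz) as (u & Hu & Hzu & Hdu).
    destruct (K u Hu) as [Hdel Kw]; specialize (Kw z Hzu).
    assert (P := Rabs_pos (v u)).
    assert (L1 : Rabs (v u) + 1 <= / d).
    { rewrite <- (Rinv_inv (Rabs (v u) + 1)); apply Rinv_le_contravar; lra. }
    assert (L2 : / (Rabs (v u) + 1) <= 1).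
    { rewrite <- Rinv_1; apply Rinv_le_contravar; lra. }
    apply Rabs_lt_between in Kw; assert (Q := Rle_abs (v u)); lra. }
  destruct Hub as [B HB].
  destruct (completeness (fun y => exists z, Cmod z <= r /\ y = v z)) as [S [HS1 HS2]].
  - exists B; intros y (z & Hz & ->); now apply HB.
  - exists (v 0), (RtoC 0); split; [now rewrite Cmod_0 | reflexivity].
  - apply NNPP; intros Hno.
    assert (Hlt : forall u, Cmod u <= r -> v u < S).
    { intros u Hu; destruct (Rlt_le_dec (v u) S) as [H|H]; [exact H|].
      exfalso; apply Hno; exists u; split; [exact Hu|]; intros z Hz.
      apply Rle_trans with S; [apply HS1; now exists z | exact H]. }
    destruct (Hdelta (fun u => if Rlt_le_dec (v u) S then (S - v u) / 2 else 1))
      as [delta K].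
    { intros u; destruct (Rlt_le_dec (v u) S); lra. }
    destruct (disc_lebesgue_number r delta) as (d & Hd & Hcov).
    { intros u Hu; now apply K. }
    assert (HSd : S <= S - d).
    { apply HS2; intros y (z & Hz & ->).
      destruct (Hcov z Hz) as (u & Hu & Hzu & Hdu).
      destruct (K u Hu) as [Hdel Kw]; specialize (Kw z Hzu).
      specialize (Hlt u Hu); destruct (Rlt_le_dec (v u) S); [|lra].
      apply Rabs_lt_between in Kw; lra. }
    lra.
Qed.

Lemma ccont_uniform f r e :
  (forall z, Cmod z <= r -> ccont f z) -> 0 < e ->
  exists d, 0 < d /\ forall z w, Cmod z <= r -> Cmod (w - z) < d -> Cmod (f w - f z) < e.
Proof.
  intros Hf He.
  assert (H : exists delta : C -> R, forall u, Cmod u <= r -> 0 < delta u /\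
    forall w, Cmod (w - u) < 2 * delta u -> Cmod (f w - f u) < e / 2).
  { apply choice_function with (R := fun u d => Cmod u <= r -> 0 < d /\
    forall w, Cmod (w - u) < 2 * d -> Cmod (f w - f u) < e / 2).
    intros u; destruct (Rle_lt_dec (Cmod u) r) as [Hu|Hu]; [|exists 0; lra].
    destruct (Hf u Hu (e / 2) ltac:(lra)) as [del [Hdel K]].
    exists (del / 2); intros _; split; [lra|]; intros w Hw; apply K; lra. }
  destruct H as [delta K].
  destruct (disc_lebesgue_number r delta) as (d & Hd & Hcov).
  { intros u Hu; now apply K. }
  exists d; split; [exact Hd|]; intros z w Hz Hw.
  destruct (Hcov z Hz) as (u & Hu & Hzu & Hdu).
  destruct (K u Hu) as [Hdel Ku].
  assert (T : Cmod (w - u) <= Cmod (w - z) + Cmod (z - u)).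
  { replace (w - u)%C with ((w - z) + (z - u))%C by ring; apply Cmod_triangle. }
  assert (K1 := Ku w ltac:(lra)); assert (K2 := Ku z ltac:(lra)).
  replace (f w - f z)%C with ((f w - f u) - (f z - f u))%C by ring.
  eapply Rle_lt_trans; [apply Cmod_triangle_sub|]; lra.
Qed.

Lemma ccont_Cmod f z e : ccont f z -> 0 < e -> exists del, 0 < del /\
     forall w, Cmod (w - z) < del -> Rabs (Cmod (f w) - Cmod (f z)) < e.
Proof.
  intros Hf He; destruct (Hf e He) as [del [Hdel K]].
  exists del; split; [exact Hdel|]; intros w Hw; specialize (K w Hw).
  assert (A1 := Cmod_triangle_inv (f w) (f z)).
  assert (A2 := Cmod_triangle_inv (f z) (f w)); rewrite Cmod_sub_comm in A2.
  apply Rabs_lt_between; lra.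
Qed.

Lemma ccont_bounded f r :
  0 <= r -> (forall z, Cmod z <= r -> ccont f z) ->
  exists B, 0 < B /\ forall z, Cmod z <= r -> Cmod (f z) <= B.
Proof.
  intros Hr Hf.
  destruct (disc_maximum r (fun z => Cmod (f z)) Hr) as (z0 & _ & H).
  - intros z Hz e He; apply ccont_Cmod; auto.
  - exists (Cmod (f z0) + 1); assert (P := Cmod_ge_0 (f z0)); split; [lra|].
    intros z Hz; specialize (H z Hz); lra.
Qed.

Lemma Cmod2_plus a b : Cmod (a + b) ^ 2 = Cmod a ^ 2 + 2 * Re (Cconj a * b) + Cmod b ^ 2.
Proof.
  rewrite !Cmod2_alt, re_mult, re_conj, im_conj, re_plus.
  unfold Im, Cplus; simpl; ring.
Qed.

(** Adding e |z|^2 makes the mean over a small circle strictly larger than the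
    value at its centre, which rules out an interior maximum; then e tends to 0.
    The point [w] is a possible removable singularity. *)
Lemma maximum_principle_Re F w r M :
  0 <= r ->
  (forall z, Cmod z <= r -> ccont F z) ->
  (forall z, Cmod z <= r -> z <> w -> cdiff F z) ->
  (forall z, Cmod z = r -> Re (F z) <= M) ->
  forall z, Cmod z <= r -> Re (F z) <= M.
Proof.
  intros Hr HC HD Hb z1 Hz1.
  assert (Heps : forall e, 0 < e -> Re (F z1) <= M + e * r ^ 2).
  { intros e He.
    destruct (disc_maximum r (fun z => Re (F z) + e * Cmod z ^ 2) Hr) as (z0 & Hz0 & Hmax).
    { intros z Hz k Hk.
      assert (HB := Cmod_ge_0 z).
      pose (B := 2 * Cmod z + 1).
      assert (Hk' : 0 < k / (2 * (e * B + 1))).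
      { apply Rdiv_lt_0_compat; [lra|]; unfold B; nra. }
      destruct (HC z Hz (k / 2) ltac:(lra)) as [d1 [Hd1 K]].
      exists (Rmin d1 (Rmin 1 (k / (2 * (e * B + 1))))); split.
      { repeat apply Rmin_pos; lra. }
      intros u Hu.
      assert (Hu1 : Cmod (u - z) < d1) by (eapply Rlt_le_trans; [exact Hu | apply Rmin_l]).
      assert (Hu2 : Cmod (u - z) < Rmin 1 (k / (2 * (e * B + 1))))
        by (eapply Rlt_le_trans; [exact Hu | apply Rmin_r]).
      assert (Hu3 : Cmod (u - z) < 1) by (eapply Rlt_le_trans; [exact Hu2 | apply Rmin_l]).
      assert (Hu4 : Cmod (u - z) < k / (2 * (e * B + 1)))
        by (eapply Rlt_le_trans; [exact Hu2 | apply Rmin_r]).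
      specialize (K u Hu1).
      assert (A1 := Cmod_triangle_inv u z).
      assert (A2 := Cmod_triangle_inv z u); rewrite Cmod_sub_comm in A2.
      assert (A3 := re_le_Cmod (F u - F z)).
      assert (A4 : Rabs (Cmod u ^ 2 - Cmod z ^ 2) <= Cmod (u - z) * B).
      { replace (Cmod u ^ 2 - Cmod z ^ 2) with ((Cmod u - Cmod z) * (Cmod u + Cmod z)) by ring.
        assert (Pu := Cmod_ge_0 u).
        rewrite Rabs_mult, (Rabs_pos_eq (Cmod u + Cmod z)) by lra.
        apply Rmult_le_compat; [apply Rabs_pos | lra | apply Rabs_le; lra | unfold B; lra]. }
      assert (A5 : e * (Cmod (u - z) * B) <= k / 2).
      { apply Rmult_lt_compat_r with (r := 2 * (e * B + 1)) in Hu4; [|unfold B; nra].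
        unfold Rdiv in Hu4; rewrite Rmult_assoc, Rinv_l in Hu4 by (unfold B; nra).
        assert (Pu := Cmod_ge_0 (u - z)); nra. }
      replace (Re (F u) + e * Cmod u ^ 2 - (Re (F z) + e * Cmod z ^ 2)) with
        (Re (F u - F z)%C + e * (Cmod u ^ 2 - Cmod z ^ 2)) by (unfold Re; simpl; ring).
      eapply Rle_lt_trans; [apply Rabs_triang|].
      rewrite Rabs_mult, (Rabs_pos_eq e) by lra.
      assert (e * Rabs (Cmod u ^ 2 - Cmod z ^ 2) <= e * (Cmod (u - z) * B))
        by (apply Rmult_le_compat_l; lra).
      lra. }
    assert (Hend : Re (F z0) + e * Cmod z0 ^ 2 <= M + e * r ^ 2).
    { destruct (Rle_lt_or_eq_dec _ _ Hz0) as [Hlt | Heq].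
      2: { specialize (Hb z0 Heq); rewrite Heq; lra. }
      exfalso.
      assert (Hrho : exists rho, 0 < rho <= r - Cmod z0 /\
        forall u, 0 < Cmod (u - z0) <= rho -> u <> w).
      { destruct (Ceq_dec w z0) as [->|Hw].
        - exists (r - Cmod z0); split; [lra|].
          intros u [Hu _] ->; rewrite Cmod_zero_sub in Hu; lra.
        - assert (P : 0 < Cmod (w - z0)) by now apply Cmod_gt_0, Cminus_eq_contra.
          exists (Rmin (r - Cmod z0) (Cmod (w - z0) / 2)); split.
          + split; [apply Rmin_pos; lra | apply Rmin_l].
          + intros u [_ Hu] ->.
            assert (Q := Rmin_r (r - Cmod z0) (Cmod (w - z0) / 2)); lra. }
      destruct Hrho as (rho & Hrho & Hne).
      assert (Hin : forall u, Cmod (u - z0) <= rho -> Cmod u <= r).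
      { intros u Hu; assert (T := Cmod_triangle_inv u z0); lra. }
      (* The linear term turns |u|^2 - |z0|^2 into |u - z0|^2, constant on the circle. *)
      assert (Hlin : forall u, cdiff (fun u => (2 * e)%R * Cconj z0 * (u - z0))%C u).
      { intros u; apply cdiff_mult; [apply cdiff_const|].
        apply cdiff_minus; [apply cdiff_id | apply cdiff_const]. }
      assert (Hc : Re (F z0) <= Re (F z0) - e * rho ^ 2).
      { replace (Re (F z0)) with (Re (F z0 + (2 * e)%R * Cconj z0 * (z0 - z0))%C) at 1.
        2: { f_equal; ring. }
        apply (circle_bound (fun u => F u + (2 * e)%R * Cconj z0 * (u - z0))%C z0 rho).
        - lra.
        - apply ccont_plus; [now apply HC | apply cdiff_ccont, Hlin].
        - intros u Hu; apply cdiff_plus; [|apply Hlin].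
          apply HD; [apply Hin; lra | now apply Hne].
        - intros u Hu; specialize (Hmax u (Hin u ltac:(lra))).
          assert (E := Cmod2_plus z0 (u - z0)).
          replace (z0 + (u - z0))%C with u in E by ring.
          rewrite Hu in E; rewrite E in Hmax.
          replace (Re (F u + (2 * e)%R * Cconj z0 * (u - z0))%C) with
            (Re (F u) + e * (2 * Re (Cconj z0 * (u - z0)))); [lra|].
          unfold Re, RtoC; simpl; ring. }
      assert (0 < e * rho ^ 2) by (apply Rmult_lt_0_compat; [lra | apply pow_lt; lra]).
      lra. }
    specialize (Hmax z1 Hz1).
    assert (0 <= e * Cmod z1 ^ 2) by (apply Rmult_le_pos; [lra | apply pow2_ge_0]).
    lra. }
  apply Rnot_lt_le; intros Hlt.
  assert (P := pow2_ge_0 r).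
  specialize (Heps ((Re (F z1) - M) / (2 * (r ^ 2 + 1)))).
  assert (He : 0 < (Re (F z1) - M) / (2 * (r ^ 2 + 1))) by (apply Rdiv_lt_0_compat; lra).
  specialize (Heps He).
  assert (E : (Re (F z1) - M) / (2 * (r ^ 2 + 1)) * (r ^ 2 + 1) = (Re (F z1) - M) / 2)
    by (field; lra).
  nra.
Qed.

Lemma maximum_modulus_principle F w r M :
  0 <= r ->
  (forall z, Cmod z <= r -> ccont F z) ->
  (forall z, Cmod z <= r -> z <> w -> cdiff F z) ->
  (forall z, Cmod z = r -> Cmod (F z) <= M) ->
  forall z, Cmod z <= r -> Cmod (F z) <= M.
Proof.
  intros Hr HC HD Hb z1 Hz1.
  destruct (Ceq_dec (F z1) 0) as [E|Hn].
  { rewrite E, Cmod_0; apply Rle_trans with (Cmod (F (RtoC r))); [apply Cmod_ge_0|].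
    apply Hb; rewrite Cmod_R; now apply Rabs_pos_eq. }
  assert (Hm : 0 < Cmod (F z1)) by now apply Cmod_gt_0.
  pose (c := (Cconj (F z1) / RtoC (Cmod (F z1)))%C).
  assert (Hm' : RtoC (Cmod (F z1)) <> 0) by (intros E; apply RtoC_inj in E; lra).
  assert (Hc : Cmod c = 1).
  { unfold c; rewrite Cmod_div, Cmod_conj, Cmod_R, Rabs_pos_eq by (auto; lra).
    field; lra. }
  assert (E : (c * F z1)%C = RtoC (Cmod (F z1))).
  { unfold c; replace (Cconj (F z1) / Cmod (F z1) * F z1)%C with
      (F z1 * Cconj (F z1) / Cmod (F z1))%C by (now field).
    rewrite <- Cmod2_conj, RtoC_pow; field; auto. }
  replace (Cmod (F z1)) with (Re (c * F z1)%C) by (rewrite E; reflexivity).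
  apply (maximum_principle_Re (fun z => c * F z)%C w r); auto.
  - intros z Hz; apply ccont_mult; [apply ccont_const | auto].
  - intros z Hz Hw; apply cdiff_mult; [apply cdiff_const | auto].
  - intros z Hz; eapply Rle_trans; [apply Rle_abs|].
    eapply Rle_trans; [apply re_le_Cmod|].
    rewrite Cmod_mult, Hc, Rmult_1_l; auto.
Qed.

(** * The Schwarz-Pick inequality for functions of positive real part *)

Lemma Cmod2_sub_conj z w :
  Cmod (1 - Cconj w * z) ^ 2 = Cmod (z - w) ^ 2 + (1 - Cmod z ^ 2) * (1 - Cmod w ^ 2).
Proof. rewrite !Cmod2_alt; unfold Re, Im; simpl; ring. Qed.

Lemma Cmod2_add_conj a b : Cmod (a + Cconj b) ^ 2 = Cmod (a - b) ^ 2 + 4 * Re a * Re b.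
Proof. rewrite !Cmod2_alt; unfold Re, Im; simpl; ring. Qed.

Lemma Rle_of_sqr_le x y : 0 <= y -> x ^ 2 <= y ^ 2 -> x <= y.
Proof. intros Hy H; apply Rnot_lt_le; intros Hlt; nra. Qed.

Lemma Re_pos_neq_0 a : 0 < Re a -> a <> 0.
Proof. intros H ->; unfold Re in H; simpl in H; lra. Qed.

(** Schwarz's lemma for b / B, where b = (p - p(w)) / (p + conj p(w)) maps the disc
    into the disc and B is the disc automorphism vanishing at [w].  The quotient is
    continuous at [w] by differentiability of [p], and on the circle |z| = r its
    modulus is at most 1 + x with x tending to 0 as r tends to 1. *)
Lemma schwarz_pick_strict p z w :
  classP p -> unit_disc z -> unit_disc w -> 0 < Re (p w) ->
  Cmod (p z - p w) * Cmod (1 - Cconj w * z) <= Cmod (z - w) * Cmod (p z + Cconj (p w)).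
Proof.
  intros [Hhol Hre] Hz Hw Hpos; rewrite holomorphic_iff in Hhol; unfold unit_disc in *.
  destruct (Hhol w Hw) as [d Hd]; apply cderiv_caratheodory in Hd.
  destruct Hd as (phi & Hphi & _ & Ephi).
  assert (Hden : forall u, Cmod u < 1 -> (p u + Cconj (p w))%C <> 0).
  { intros u Hu; apply Re_pos_neq_0; rewrite re_plus, re_conj; specialize (Hre u Hu); lra. }
  assert (Dphi : forall u, Cmod u < 1 -> u <> w -> cdiff phi u).
  { intros u Hu Hne.
    assert (P : 0 < Cmod (u - w)) by now apply Cmod_gt_0, Cminus_eq_contra.
    apply cdiff_loc with (fun u => (p u - p w) / (u - w))%C.
    - exists (Cmod (u - w)); split; [exact P|]; intros v Hv.
      rewrite (Ephi v); field.
      intros E; rewrite <- (Cmod_0), <- E in P.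
      assert (Ev : v = w) by (replace v with (v - w + w)%C by ring; rewrite E; ring).
      rewrite Ev, Cmod_sub_comm in Hv; lra.
    - apply cdiff_div; [| |now apply Cminus_eq_contra].
      + apply cdiff_minus; [now apply Hhol | apply cdiff_const].
      + apply cdiff_minus; [apply cdiff_id | apply cdiff_const]. }
  pose (G := fun u => (phi u * ((1 - Cconj w * u) / (p u + Cconj (p w))))%C).
  assert (Dfac : forall u, Cmod u < 1 ->
    cdiff (fun u => (1 - Cconj w * u) / (p u + Cconj (p w)))%C u).
  { intros u Hu; apply cdiff_div; [| |now apply Hden].
    - apply cdiff_minus; [apply cdiff_const|].
      apply cdiff_mult; [apply cdiff_const | apply cdiff_id].
    - apply cdiff_plus; [now apply Hhol | apply cdiff_const]. }
  assert (HG : Cmod (G z) <= 1).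
  { apply Rnot_lt_le; intros Hgt.
    set (eta := Cmod (G z) - 1) in *.
    assert (Heta : 0 < eta) by (unfold eta; lra).
    assert (P0 := Cmod_ge_0 w).
    (* With r - |w| >= (1 - |w|) / 2, these bounds give x < eta for the x below. *)
    assert (Hr : exists r, Cmod z < r < 1 /\ (1 + Cmod w) / 2 < r /\
        8 * (1 - r) < eta * (1 - Cmod w) ^ 2).
    { pose (m := Rmin (1 - Cmod z) (Rmin ((1 - Cmod w) / 2) (eta * (1 - Cmod w) ^ 2 / 8))).
      assert (H2 : 0 < (1 - Cmod w) ^ 2) by (apply pow_lt; lra).
      assert (Hm : 0 < m).
      { repeat apply Rmin_pos; nra. }
      assert (M1 : m <= 1 - Cmod z) by apply Rmin_l.
      assert (M2 : m <= Rmin ((1 - Cmod w) / 2) (eta * (1 - Cmod w) ^ 2 / 8)) by apply Rmin_r.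
      assert (M3 := Rmin_l ((1 - Cmod w) / 2) (eta * (1 - Cmod w) ^ 2 / 8)).
      assert (M4 := Rmin_r ((1 - Cmod w) / 2) (eta * (1 - Cmod w) ^ 2 / 8)).
      exists (1 - m / 2); lra. }
    destruct Hr as (r & Hr1 & Hr2 & Hr3).
    assert (Hrw : 0 < r - Cmod w) by lra.
    assert (Hrw2 : 0 < (r - Cmod w) ^ 2) by now apply pow_lt.
    pose (x := (1 - r ^ 2) / (r - Cmod w) ^ 2).
    assert (Ex : x * (r - Cmod w) ^ 2 = 1 - r ^ 2) by (unfold x; field; lra).
    assert (Hz0 := Cmod_ge_0 z).
    assert (Hx : x < eta).
    { apply Rmult_lt_reg_r with ((r - Cmod w) ^ 2); [exact Hrw2|]; rewrite Ex.
      apply Rle_lt_trans with (2 * (1 - r)); [nra|].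
      apply Rlt_le_trans with (eta * ((1 - Cmod w) ^ 2 / 4)); [lra|].
      apply Rmult_le_compat_l; [lra|]; nra. }
    assert (Hx0 : 0 <= x) by (apply Rlt_le, Rdiv_lt_0_compat; nra).
    assert (Hle : Cmod (G z) <= 1 + x); [|unfold eta in Hx; lra].
    apply (maximum_modulus_principle G w r); try lra.
    - intros u Hu; apply ccont_mult; [|apply cdiff_ccont, Dfac; lra].
      destruct (Ceq_dec u w) as [->|Hne]; [exact Hphi|].
      apply cdiff_ccont, Dphi; [lra | exact Hne].
    - intros u Hu Hne; apply cdiff_mult; [apply Dphi | apply Dfac]; auto; lra.
    - intros u Hu.
      assert (Hu1 : Cmod u < 1) by lra.
      pose proof (Hden u Hu1) as Hn.
      assert (Hdp : 0 < Cmod (p u + Cconj (p w))) by now apply Cmod_gt_0.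
      assert (Hs : r - Cmod w <= Cmod (u - w)) by (rewrite <- Hu; apply Cmod_triangle_inv).
      assert (Hsp : 0 < Cmod (u - w)) by lra.
      assert (EG : Cmod (G u) * Cmod (u - w) * Cmod (p u + Cconj (p w)) =
                   Cmod (p u - p w) * Cmod (1 - Cconj w * u)).
      { rewrite <- !Cmod_mult; f_equal; unfold G.
        replace (p u - p w)%C with (phi u * (u - w))%C by (rewrite (Ephi u); ring).
        field; exact Hn. }
      assert (Hnum : Cmod (p u - p w) <= Cmod (p u + Cconj (p w))).
      { apply Rle_of_sqr_le; [lra|]; rewrite Cmod2_add_conj.
        assert (0 <= Re (p u) * Re (p w)) by (apply Rmult_le_pos; [now apply Hre | lra]).
        lra. }
      assert (HGs : Cmod (G u) * Cmod (u - w) <= Cmod (1 - Cconj w * u)).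
      { apply Rmult_le_reg_r with (Cmod (p u + Cconj (p w))); [exact Hdp|].
        rewrite EG, Rmult_comm; apply Rmult_le_compat_l; [apply Cmod_ge_0 | exact Hnum]. }
      assert (HT : Cmod (1 - Cconj w * u) <= (1 + x) * Cmod (u - w)).
      { apply Rle_of_sqr_le; [apply Rmult_le_pos; lra|]; rewrite Cmod2_sub_conj, Hu.
        assert (Q1 : (1 - r ^ 2) * (1 - Cmod w ^ 2) <= 1 - r ^ 2).
        { assert (0 <= (1 - r ^ 2) * Cmod w ^ 2); [|lra].
          apply Rmult_le_pos; [nra | apply pow2_ge_0]. }
        assert (Q2 : 1 - r ^ 2 <= x * Cmod (u - w) ^ 2).
        { rewrite <- Ex; apply Rmult_le_compat_l; [exact Hx0|]; apply pow_incr; lra. }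
        assert (Q3 : 0 <= x * x * Cmod (u - w) ^ 2)
          by (apply Rmult_le_pos; [nra | apply pow2_ge_0]).
        assert (Q4 : 0 <= x * Cmod (u - w) ^ 2)
          by (apply Rmult_le_pos; [nra | apply pow2_ge_0]).
        nra. }
      apply Rmult_le_reg_r with (Cmod (u - w)); lra. }
  assert (Hn := Hden z Hz).
  assert (EG : Cmod (p z - p w) * Cmod (1 - Cconj w * z) =
     Cmod (G z) * (Cmod (z - w) * Cmod (p z + Cconj (p w)))).
  { rewrite <- !Cmod_mult; f_equal; unfold G.
    replace (p z - p w)%C with (phi z * (z - w))%C by (rewrite (Ephi z); ring).
    field; exact Hn. }
  rewrite EG.
  assert (0 <= Cmod (z - w) * Cmod (p z + Cconj (p w)))
    by (apply Rmult_le_pos; apply Cmod_ge_0).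
  nra.
Qed.

(** Nonnegativity of the two-point Pick determinant.  The form without quotients
    allows Re (p w) = 0; it is obtained from [p + eta] by letting eta tend to 0. *)
Lemma pick_inequality p z w :
  classP p -> unit_disc z -> unit_disc w ->
  (1 - Cmod z ^ 2) * (1 - Cmod w ^ 2) * Cmod (p z + Cconj (p w)) ^ 2 <=
  4 * Re (p z) * Re (p w) * Cmod (1 - Cconj w * z) ^ 2.
Proof.
  intros Hp Hz Hw.
  assert (Hpz := proj2 Hp z Hz); assert (Hpw := proj2 Hp w Hw).
  set (D := (1 - Cmod z ^ 2) * (1 - Cmod w ^ 2)).
  assert (HD : 0 <= D).
  { unfold unit_disc in *; assert (A := Cmod_ge_0 z); assert (B := Cmod_ge_0 w).
    unfold D; apply Rmult_le_pos; nra. }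
  assert (Heta : forall eta, 0 < eta ->
    D * Cmod (p z + eta + Cconj (p w + eta)) ^ 2 <=
    4 * (Re (p z) + eta) * (Re (p w) + eta) * Cmod (1 - Cconj w * z) ^ 2).
  { intros eta He.
    assert (HP : classP (fun u => p u + eta)%C).
    { split.
      - apply holomorphic_iff; intros u Hu; apply cdiff_plus; [|apply cdiff_const].
        now apply holomorphic_iff; [apply Hp|].
      - intros u Hu; rewrite re_plus, re_RtoC; assert (H := proj2 Hp u Hu); lra. }
    assert (H := schwarz_pick_strict _ z w HP Hz Hw).
    cbv beta in H; rewrite re_plus, re_RtoC in H; specialize (H ltac:(lra)).
    assert (HA := Cmod2_sub_conj z w); fold D in HA.
    assert (HB := Cmod2_add_conj (p z + eta) (p w + eta)).
    rewrite !re_plus, !re_RtoC in HB.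
    set (T := Cmod (1 - Cconj w * z)) in *.
    set (S := Cmod (p z + eta + Cconj (p w + eta))) in *.
    set (N := Cmod (p z + eta - (p w + eta))) in *.
    set (Q := Cmod (z - w)) in *.
    assert (0 <= T) by apply Cmod_ge_0; assert (0 <= S) by apply Cmod_ge_0.
    assert (0 <= N) by apply Cmod_ge_0; assert (0 <= Q) by apply Cmod_ge_0.
    assert (K : (N * T) ^ 2 <= (Q * S) ^ 2) by (apply pow_incr; split; nra).
    rewrite !Rpow_mult_distr in K.
    assert (EQ : Q ^ 2 = T ^ 2 - D) by lra.
    assert (EN : N ^ 2 = S ^ 2 - 4 * (Re (p z) + eta) * (Re (p w) + eta)) by lra.
    rewrite EQ, EN in K; lra. }
  set (a := Re (p z)) in *; set (b := Re (p w)) in *.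
  set (T := Cmod (1 - Cconj w * z) ^ 2) in *.
  assert (HT : 0 <= T) by apply pow2_ge_0.
  apply Rnot_lt_le; intros Hlt.
  set (gap := D * Cmod (p z + Cconj (p w)) ^ 2 - 4 * a * b * T) in *.
  assert (Hgap : 0 < gap) by (unfold gap; lra).
  pose (K := 4 * (a + b + 1) * T + 1).
  assert (HK : 0 < K) by (unfold K; nra).
  pose (eta := Rmin 1 (gap / (2 * K))).
  assert (He : 0 < eta) by (apply Rmin_pos; [lra | apply Rdiv_lt_0_compat; lra]).
  assert (He1 : eta <= 1) by apply Rmin_l.
  assert (He2 : eta * K <= gap / 2).
  { apply Rle_trans with (gap / (2 * K) * K).
    - apply Rmult_le_compat_r; [lra | apply Rmin_r].
    - right; field; lra. }
  specialize (Heta eta He).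
  assert (ES : Cmod (p z + Cconj (p w)) ^ 2 <= Cmod (p z + eta + Cconj (p w + eta)) ^ 2).
  { rewrite !Cmod2_alt, !re_plus, !re_conj, !re_plus, !re_RtoC.
    fold a b.
    replace (Im (p z + eta + Cconj (p w + eta))) with (Im (p z + Cconj (p w)))
      by (unfold Im; simpl; ring).
    nra. }
  assert (E1 : D * Cmod (p z + Cconj (p w)) ^ 2 <=
    D * Cmod (p z + eta + Cconj (p w + eta)) ^ 2) by now apply Rmult_le_compat_l.
  assert (E2 : 4 * (a + eta) * (b + eta) * T <= 4 * a * b * T + eta * K).
  { unfold K.
    assert (0 <= (1 - eta) * eta * T) by (apply Rmult_le_pos; nra).
    nra. }
  unfold gap in *; lra.
Qed.

(** * Boundary behaviour at 1 and Julia's inequality *)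

Lemma locally_C_Cmod (z : C) (P : C -> Prop) :
  locally (T := C_UniformSpace) z P <->
  exists del, 0 < del /\ forall w, Cmod (w - z) < del -> P w.
Proof.
  split.
  - intros H; apply (locally_C z P) in H; destruct H as [d Hd].
    exists d; split; [apply cond_pos | exact Hd].
  - intros (d & Hd & K); apply (locally_C z P); exists (mkposreal d Hd); exact K.
Qed.

Lemma angular_lim_eps f l M e :
  angular_lim f l -> 1 < M -> 0 < e -> exists del, 0 < del /\
    forall z, Stolz M z -> Cmod (z - 1) < del -> Cmod (f z - l) < e.
Proof.
  intros H HM He.
  assert (L : locally (T := C_UniformSpace) l (fun y => Cmod (y - l) < e)).
  { apply locally_C_Cmod; exists e; auto. }
  specialize (H M HM _ L); unfold filtermap, to_one, within in H.
  apply locally_C_Cmod in H; destruct H as (d & Hd & K).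
  exists d; split; [exact Hd|]; intros z Hz Hz1; now apply K.
Qed.

(** A sequence on the radius, which lies in every Stolz region; limits
    along it determine angular limits. *)
Definition radial (n : nat) : R := 1 - / (INR n + 2).

Lemma radial_bounds n : 0 < radial n < 1.
Proof.
  unfold radial; assert (P := pos_INR n).
  assert (A : 0 < / (INR n + 2)) by (apply Rinv_0_lt_compat; lra).
  assert (B : / (INR n + 2) < 1) by (rewrite <- Rinv_1; apply Rinv_lt_contravar; lra).
  lra.
Qed.

Lemma radial_lim : is_lim_seq radial 1.
Proof.
  unfold radial; replace (Finite 1) with (Finite (1 - 0)) by (f_equal; ring).
  apply is_lim_seq_minus'; [apply is_lim_seq_const|].
  replace (Finite 0) with (Rbar_inv p_infty) by reflexivity.
  apply is_lim_seq_inv; [|discriminate].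
  apply is_lim_seq_plus with p_infty 2; [apply is_lim_seq_INR | apply is_lim_seq_const | reflexivity].
Qed.

Lemma radial_Stolz n : Stolz 2 (RtoC (radial n)).
Proof.
  assert (H := radial_bounds n); split.
  - unfold unit_disc; rewrite Cmod_R, Rabs_pos_eq; lra.
  - rewrite <- RtoC_minus, !Cmod_R, !Rabs_pos_eq; lra.
Qed.

Lemma angular_lim_radial f l :
  angular_lim f l ->
  is_lim_seq (fun n => Re (f (RtoC (radial n)))) (Re l) /\
  is_lim_seq (fun n => Im (f (RtoC (radial n)))) (Im l).
Proof.
  intros H.
  assert (K : forall e : posreal, eventually (fun n => Cmod (f (RtoC (radial n)) - l) < e)).
  { intros e; destruct (angular_lim_eps f l 2 e H ltac:(lra) (cond_pos e)) as (d & Hd & K).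
    destruct (proj2 (is_lim_seq_spec _ _) radial_lim (mkposreal d Hd)) as [N HN].
    exists N; intros n Hn; apply K; [apply radial_Stolz|].
    rewrite <- RtoC_minus, Cmod_R; now apply HN. }
  split; apply is_lim_seq_spec; intros e; destruct (K e) as [N HN]; exists N; intros n Hn;
    specialize (HN n Hn); eapply Rle_lt_trans; [|exact HN| |exact HN].
  - apply (re_le_Cmod (f (radial n) - l)%C).
  - apply (im_le_Cmod (f (radial n) - l)%C).
Qed.

Lemma angular_lim_unique f l l' : angular_lim f l -> angular_lim f l' -> l = l'.
Proof.
  intros H H'; apply angular_lim_radial in H, H'.
  destruct H as [H1 H2], H' as [H1' H2'].
  apply is_lim_seq_unique in H1, H2, H1', H2'.
  rewrite H1 in H1'; rewrite H2 in H2'; injection H1'; injection H2'.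
  intros E1 E2; destruct l, l'; unfold Re, Im in *; simpl in *; congruence.
Qed.

(** Near 1 the function [q] is close to alpha (1 - z); approaching along
    z = 1 - e (1 + i k), a nontangential direction, the inequality Re q >= 0 becomes
    Re (alpha (1 + i k)) >= 0.  Since [k] is arbitrary, [alpha] is real and
    nonnegative. *)
Lemma angular_derivative_halfplane q alpha k :
  classP q -> angular_derivative q (- alpha)%C -> 0 <= Re (alpha * (1, k))%C.
Proof.
  intros [_ Hre] Hd.
  set (u := ((1, k) : C)).
  assert (Hu : 1 <= Cmod u).
  { assert (A := re_le_Cmod u); unfold u in A at 1; unfold Re in A; simpl in A.
    rewrite Rabs_R1 in A; exact A. }
  apply Rnot_lt_le; intros Hneg.
  assert (He : 0 < - Re (alpha * u) / Cmod u) by (apply Rdiv_lt_0_compat; lra).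
  destruct (angular_lim_eps _ _ (2 * Cmod u + 2) _ Hd ltac:(lra) He) as (del & Hdel & K).
  (* The first bound keeps 1 - |z| of the order of e, that is, z in the Stolz region. *)
  pose (e := Rmin (/ Cmod u ^ 2) (del / (2 * Cmod u))).
  assert (Hu2 : 0 < Cmod u ^ 2) by (apply pow_lt; lra).
  assert (Hep : 0 < e).
  { apply Rmin_pos; [now apply Rinv_0_lt_compat | apply Rdiv_lt_0_compat; lra]. }
  assert (He1 : e * Cmod u ^ 2 <= 1).
  { apply Rle_trans with (/ Cmod u ^ 2 * Cmod u ^ 2).
    - apply Rmult_le_compat_r; [lra | apply Rmin_l].
    - right; field; lra. }
  assert (He2 : e * Cmod u < del).
  { apply Rle_lt_trans with (del / (2 * Cmod u) * Cmod u).
    - apply Rmult_le_compat_r; [lra | apply Rmin_r].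
    - replace (del / (2 * Cmod u) * Cmod u) with (del / 2) by (field; lra); lra. }
  pose (z := (1 - e * u)%C).
  assert (Ez1 : (z - 1)%C = (- (e * u))%C) by (unfold z; ring).
  assert (Hz1 : Cmod (z - 1) = e * Cmod u).
  { rewrite Ez1, Cmod_opp, Cmod_mult, Cmod_R, Rabs_pos_eq; lra. }
  assert (Hz2 : Cmod z ^ 2 = 1 - 2 * e + e * (e * Cmod u ^ 2)).
  { rewrite !Cmod2_alt; unfold z, u, Re, Im; simpl; ring. }
  assert (Hz0 := Cmod_ge_0 z).
  assert (Hz3 : Cmod z ^ 2 <= 1 - e) by nra.
  assert (Hz : Cmod z < 1) by nra.
  assert (HS : Stolz (2 * Cmod u + 2) z).
  { split; [exact Hz|]; rewrite Cmod_sub_comm, Hz1.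
    assert (e / 2 <= 1 - Cmod z) by nra.
    nra. }
  specialize (K z HS ltac:(lra)).
  specialize (Hre z Hz).
  assert (Hn : (z - 1)%C <> 0) by (apply Cmod_gt_0; rewrite Hz1; nra).
  assert (Eq : q z = ((q z / (z - 1) - - alpha) * (z - 1) + e * (alpha * u))%C).
  { replace (e * (alpha * u))%C with (- alpha * (z - 1))%C by (rewrite Ez1; ring).
    field; exact Hn. }
  set (w := (q z / (z - 1) - - alpha)%C) in *.
  rewrite Eq, re_plus, re_scal_l in Hre.
  assert (B := re_le_Cmod (w * (z - 1))); rewrite Cmod_mult, Hz1 in B.
  assert (B' := Rle_abs (Re (w * (z - 1)))).
  assert (B2 : Cmod w * Cmod u < - Re (alpha * u)).
  { apply Rmult_lt_compat_r with (r := Cmod u) in K; [|lra].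
    unfold Rdiv in K; rewrite Rmult_assoc, Rinv_l in K by lra; lra. }
  nra.
Qed.

Lemma angular_derivative_positive q alpha :
  classP q -> conformal_at_one q -> angular_derivative q (- alpha)%C ->
  Im alpha = 0 /\ 0 < Re alpha.
Proof.
  intros Hq (d & Hd & Hdn) Ha.
  assert (H : forall k, 0 <= Re alpha - k * Im alpha).
  { intros k; assert (A := angular_derivative_halfplane q alpha k Hq Ha).
    rewrite re_mult in A; unfold Re at 2, Im at 2 in A; simpl in A; lra. }
  assert (HI : Im alpha = 0).
  { apply NNPP; intros Hn; specialize (H ((Re alpha + 1) / Im alpha)).
    unfold Rdiv in H; rewrite Rmult_assoc, Rinv_l in H by exact Hn; lra. }
  split; [exact HI|].
  specialize (H 0); destruct (Rle_lt_or_eq_dec 0 (Re alpha)) as [Hlt|Heq]; [lra|exact Hlt|].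
  exfalso; apply Hdn; rewrite (angular_lim_unique _ _ _ Hd Ha).
  replace alpha with (RtoC 0); [ring|].
  destruct alpha as [x y]; unfold Re, Im in *; simpl in *; subst; reflexivity.
Qed.

(** The Pick inequality between [z] = u + i v, where the function has the value
    X + i Y, and the points [x n] of the radius, where it has the values
    a n + i b n; [c n] stands for Re (q (x n)) / (1 - x n). *)
Lemma pick_inequality_passes_to_limit (x a b c : nat -> R) (D X Y u v la lb lc : R) :
  is_lim_seq x 1 -> is_lim_seq a la -> is_lim_seq b lb -> is_lim_seq c lc ->
  (forall n, D * (1 + x n) * ((X + a n) * (X + a n) + (Y - b n) * (Y - b n)) <=
     4 * X * c n * ((1 - x n * u) * (1 - x n * u) + x n * v * (x n * v))) ->
  D * (1 + 1) * ((X + la) * (X + la) + (Y - lb) * (Y - lb)) <=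
     4 * X * lc * ((1 - 1 * u) * (1 - 1 * u) + 1 * v * (1 * v)).
Proof.
  intros Lx La Lb Lc H.
  assert (K : forall k, is_lim_seq (fun _ => k) k) by exact is_lim_seq_const.
  assert (SX := is_lim_seq_plus' _ _ _ _ (K X) La).
  assert (SY := is_lim_seq_minus' _ _ _ _ (K Y) Lb).
  assert (SU := is_lim_seq_minus' _ _ _ _ (K 1) (is_lim_seq_mult' _ _ _ _ Lx (K u))).
  assert (SV := is_lim_seq_mult' _ _ _ _ Lx (K v)).
  assert (SL := is_lim_seq_mult' _ _ _ _
    (is_lim_seq_mult' _ _ _ _ (K D) (is_lim_seq_plus' _ _ _ _ (K 1) Lx))
    (is_lim_seq_plus' _ _ _ _ (is_lim_seq_mult' _ _ _ _ SX SX) (is_lim_seq_mult' _ _ _ _ SY SY))).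
  assert (SR := is_lim_seq_mult' _ _ _ _ (is_lim_seq_mult' _ _ _ _ (K (4 * X)) Lc)
    (is_lim_seq_plus' _ _ _ _ (is_lim_seq_mult' _ _ _ _ SU SU) (is_lim_seq_mult' _ _ _ _ SV SV))).
  exact (is_lim_seq_le _ _ _ _ H SL SR).
Qed.

(** Pick's inequality for [z] and a point x of the radius, divided by 1 - x: as
    x tends to 1, q(x) tends to 0 and Re q(x) / (1 - x) tends to Re alpha. *)
Lemma julia_inequality q alpha z :
  classP q -> angular_lim q 0 -> angular_derivative q (- alpha)%C -> unit_disc z ->
  (1 - Cmod z ^ 2) * Cmod (q z) ^ 2 <= 2 * Re alpha * Re (q z) * Cmod (1 - z) ^ 2.
Proof.
  intros Hq H0 Hd Hz.
  destruct (angular_lim_radial _ _ H0) as [L1 L2].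
  destruct (angular_lim_radial _ _ Hd) as [L3 _].
  apply is_lim_seq_opp in L3; cbn [Rbar_opp] in L3.
  assert (L := pick_inequality_passes_to_limit _ _ _ _ (1 - Cmod z ^ 2) (Re (q z)) (Im (q z))
    (Re z) (Im z) _ _ _ radial_lim L1 L2 L3).
  cbv beta in L.
  replace (Cmod (1 - z) ^ 2) with ((1 - 1 * Re z) * (1 - 1 * Re z) + 1 * Im z * (1 * Im z))
    by (rewrite Cmod2_alt; unfold Re, Im; simpl; ring).
  rewrite (Cmod2_alt (q z)).
  replace (- Re (- alpha)%C) with (Re alpha) in L by (unfold Re; simpl; ring).
  replace (Re 0) with 0 in L by reflexivity.
  replace (Im 0) with 0 in L by reflexivity.
  cut (forall n, (1 - Cmod z ^ 2) * (1 + radial n) *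
      ((Re (q z) + Re (q (radial n))) * (Re (q z) + Re (q (radial n))) +
       (Im (q z) - Im (q (radial n))) * (Im (q z) - Im (q (radial n)))) <=
    4 * Re (q z) * (- Re (q (radial n) / (radial n - 1))%C) *
      ((1 - radial n * Re z) * (1 - radial n * Re z) + radial n * Im z * (radial n * Im z))).
  { intros H; specialize (L H); lra. }
  intros n.
  assert (Hr := radial_bounds n).
  assert (P := pick_inequality q z (RtoC (radial n)) Hq Hz (proj1 (radial_Stolz n))).
  set (x := radial n) in *.
  rewrite (Cmod_R x), (Rabs_pos_eq x) in P by lra.
  assert (Eq : - Re (q x / (x - 1))%C * (1 - x) = Re (q x)).
  { replace (q x / (x - 1))%C with (RtoC (/ (x - 1)) * q x)%C.
    - rewrite re_scal_l; field; lra.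
    - rewrite RtoC_inv, RtoC_minus by lra; unfold Cdiv; ring. }
  apply Rmult_le_reg_r with (1 - x); [lra|].
  replace (4 * Re (q z) * - Re (q x / (x - 1)) *
    ((1 - x * Re z) * (1 - x * Re z) + x * Im z * (x * Im z)) * (1 - x)) with
    (4 * Re (q z) * (- Re (q x / (x - 1)) * (1 - x)) *
    ((1 - x * Re z) * (1 - x * Re z) + x * Im z * (x * Im z))) by ring.
  rewrite Eq.
  replace ((1 - x * Re z) * (1 - x * Re z) + x * Im z * (x * Im z)) with
    (Cmod (1 - Cconj x * z) ^ 2) by (rewrite Cmod2_alt; unfold Re, Im; simpl; ring).
  eapply Rle_trans; [|exact P].
  right; rewrite (Cmod2_alt (q z + _)), re_plus, re_conj.
  replace (Im (q z + Cconj (q x))) with (Im (q z) - Im (q x)) by (unfold Im; simpl; ring).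
  ring.
Qed.

(** If Re q vanished at a point, Pick's inequality would force [q] to be constant,
    hence zero, against the nonzero angular derivative. *)
Lemma Re_pos_of_angular_derivative q alpha z :
  classP q -> angular_lim q 0 -> angular_derivative q (- alpha)%C -> 0 < Re alpha ->
  unit_disc z -> 0 < Re (q z).
Proof.
  intros Hq H0 Hd Ha Hz.
  destruct (proj2 Hq z Hz) as [Hlt|Heq]; [exact Hlt|exfalso].
  assert (Hconst : forall u, unit_disc u -> q u = (- Cconj (q z))%C).
  { intros u Hu; assert (P := pick_inequality q u z Hq Hu Hz).
    rewrite <- Heq, Rmult_0_r, Rmult_0_l in P.
    unfold unit_disc in *; assert (A := Cmod_ge_0 u); assert (B := Cmod_ge_0 z).
    assert (D : 0 < (1 - Cmod u ^ 2) * (1 - Cmod z ^ 2)) by (apply Rmult_lt_0_compat; nra).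
    assert (E : Cmod (q u + Cconj (q z)) = 0).
    { assert (N := Cmod_ge_0 (q u + Cconj (q z))).
      destruct N as [N|N]; [|now symmetry].
      assert (0 < Cmod (q u + Cconj (q z)) ^ 2) by now apply pow_lt.
      nra. }
    apply Cmod_eq_0 in E.
    replace (q u) with (q u + Cconj (q z) - Cconj (q z))%C by ring.
    rewrite E; ring. }
  set (c := (- Cconj (q z))%C) in *.
  assert (Hc : c = 0).
  { apply (angular_lim_unique q); [|exact H0].
    intros M HM P HP; apply locally_C_Cmod; exists 1; split; [lra|].
    intros w _ [Hw _]; rewrite Hconst by exact Hw; now apply locally_singleton. }
  assert (Hz0 : (- alpha)%C = 0).
  { apply (angular_lim_unique (fun z => q z / (z - 1))%C); [exact Hd|].
    intros M HM P HP; apply locally_C_Cmod; exists 1; split; [lra|].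
    intros w _ [Hw _]; rewrite Hconst by exact Hw.
    replace (c / (w - 1))%C with (RtoC 0); [now apply locally_singleton|].
    rewrite Hc; unfold Cdiv; ring. }
  assert (E := f_equal Re Hz0); rewrite re_opp in E; unfold Re in E; simpl in E.
  unfold Re in Ha; lra.
Qed.

(** * Herglotz kernels and interpolation at one point *)

(** The Herglotz kernel of the point conj om; for om = 1 it is the extremal
    function (1 + z) / (1 - z) with pole at the boundary point 1. *)
Definition herglotz (om z : C) : C := ((1 + om * z) / (1 - om * z))%C.

Lemma Re_inv (z : C) : Re (/ z)%C = Re z / Cmod z ^ 2.
Proof.
  rewrite Cmod2_alt; reflexivity.
Qed.

Lemma Re_cayley v : Cmod v < 1 -> Re ((1 + v) / (1 - v))%C = (1 - Cmod v ^ 2) / Cmod (1 - v) ^ 2.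
Proof.
  intros Hv.
  assert (Hn : (1 - v)%C <> 0).
  { intros E; assert (v = 1) by (replace v with (1 - (1 - v))%C by ring; rewrite E; ring).
    subst v; rewrite Cmod_1 in Hv; lra. }
  assert (H : 0 < Cmod (1 - v)) by now apply Cmod_gt_0.
  assert (H2 : 0 < Cmod (1 - v) ^ 2) by now apply pow_lt.
  unfold Cdiv; rewrite re_mult, Re_inv.
  assert (EI : Im (/ (1 - v))%C = Im v / Cmod (1 - v) ^ 2).
  { rewrite Cmod2_alt; unfold Im, Re, Cinv; simpl; unfold Rdiv; f_equal; ring. }
  rewrite EI.
  replace (1 - Cmod v ^ 2) with (Re (1 + v) * Re (1 - v) - Im (1 + v) * Im v)
    by (rewrite Cmod2_alt; unfold Re, Im; simpl; ring).
  field; lra.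
Qed.

Lemma Cmod_mult_le om z : Cmod om <= 1 -> Cmod (om * z) <= Cmod z.
Proof. intros H; rewrite Cmod_mult; assert (P := Cmod_ge_0 z); nra. Qed.

Lemma one_minus_lower v r : Cmod v <= r -> 1 - r <= Cmod (1 - v).
Proof. intros H; assert (T := Cmod_triangle_inv 1 v); rewrite Cmod_1 in T; lra. Qed.

Lemma one_minus_neq_0 v : Cmod v < 1 -> (1 - v)%C <> 0.
Proof. intros H; apply Cmod_gt_0; assert (L := one_minus_lower v (Cmod v) (Rle_refl _)); lra. Qed.

Lemma herglotz_diff om z : Cmod om <= 1 -> unit_disc z -> cdiff (herglotz om) z.
Proof.
  intros Ho Hz; assert (H := Cmod_mult_le om z Ho); unfold unit_disc in Hz.
  assert (D : cdiff (fun w => om * w)%C z)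
    by (apply cdiff_mult; [apply cdiff_const | apply cdiff_id]).
  apply cdiff_div; [apply cdiff_plus | apply cdiff_minus | apply one_minus_neq_0; lra];
    auto; apply cdiff_const.
Qed.

Lemma herglotz_Re_lower om z :
  Cmod om <= 1 -> unit_disc z -> (1 - Cmod z ^ 2) / 4 <= Re (herglotz om z).
Proof.
  intros Ho Hz; assert (H := Cmod_mult_le om z Ho); unfold unit_disc in Hz.
  unfold herglotz; rewrite Re_cayley by lra.
  assert (P := Cmod_ge_0 (om * z)).
  assert (L := one_minus_lower (om * z) (Cmod (om * z)) (Rle_refl _)).
  assert (U := Cmod_triangle_sub 1 (om * z)); rewrite Cmod_1 in U.
  assert (H2 : 0 < Cmod (1 - om * z) ^ 2) by (apply pow_lt; lra).
  assert (H4 : Cmod (1 - om * z) ^ 2 <= 4) by nra.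
  unfold Rdiv; apply Rmult_le_compat; [nra | lra | nra |].
  apply Rinv_le_contravar; lra.
Qed.

Lemma herglotz_bound om z r :
  Cmod om <= 1 -> Cmod z <= r -> r < 1 -> Cmod (herglotz om z) <= 2 / (1 - r).
Proof.
  intros Ho Hz Hr; assert (H := Cmod_mult_le om z Ho).
  assert (L := one_minus_lower (om * z) r ltac:(lra)).
  unfold herglotz; rewrite Cmod_div by (apply one_minus_neq_0; lra).
  assert (U := Cmod_triangle 1 (om * z)); rewrite Cmod_1 in U.
  unfold Rdiv; apply Rmult_le_compat;
    [apply Cmod_ge_0 | left; apply Rinv_0_lt_compat; lra | lra |].
  apply Rinv_le_contravar; lra.
Qed.

Lemma herglotz_close om z r :
  Cmod om <= 1 -> Cmod z <= r -> r < 1 ->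
  Cmod (herglotz om z - herglotz 1 z) <= 2 * Cmod (om - 1) / (1 - r) ^ 2.
Proof.
  intros Ho Hz Hr; assert (H := Cmod_mult_le om z Ho).
  assert (L := one_minus_lower (om * z) r ltac:(lra)).
  assert (L1 := one_minus_lower z r Hz).
  assert (N := one_minus_neq_0 (om * z) ltac:(lra)).
  assert (N1 := one_minus_neq_0 z ltac:(lra)).
  replace (herglotz om z - herglotz 1 z)%C with
    (2 * z * (om - 1) / ((1 - om * z) * (1 - z)))%C.
  2: { unfold herglotz; field; repeat split; auto. }
  rewrite Cmod_div by now apply Cmult_neq_0.
  rewrite !Cmod_mult, Cmod_R, Rabs_pos_eq by lra.
  assert (P := Cmod_ge_0 z); assert (P' := Cmod_ge_0 (om - 1)).
  unfold Rdiv; apply Rmult_le_compat; [nra | left; apply Rinv_0_lt_compat; nra | nra |].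
  apply Rinv_le_contravar; [apply pow_lt; lra | simpl; rewrite Rmult_1_r].
  apply Rmult_le_compat; lra.
Qed.

Lemma classP_inv h : holomorphic_on_disc h -> (forall z, unit_disc z -> 0 < Re (h z)) ->
  classP (fun z => / h z)%C.
Proof.
  intros Hh Hp; split.
  - apply holomorphic_iff; intros z Hz; apply cdiff_inv.
    + now apply holomorphic_iff.
    + now apply Re_pos_neq_0, Hp.
  - intros z Hz; specialize (Hp z Hz).
    assert (N := Re_pos_neq_0 _ Hp).
    rewrite Re_inv.
    left; apply Rdiv_lt_0_compat; [exact Hp | apply pow_lt; now apply Cmod_gt_0].
Qed.

(** Julia's inequality says exactly that removing the pole of 1 / q at 1, of
    weight 1 / (2 a), leaves a function of nonnegative real part. *)
Lemma remainder_classP q a :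
  0 < a -> holomorphic_on_disc q -> (forall z, unit_disc z -> 0 < Re (q z)) ->
  (forall z, unit_disc z ->
     (1 - Cmod z ^ 2) * Cmod (q z) ^ 2 <= 2 * a * Re (q z) * Cmod (1 - z) ^ 2) ->
  classP (fun z => / q z - RtoC (/ (2 * a)) * herglotz 1 z)%C.
Proof.
  intros Ha Hh Hp HJ.
  assert (H1 : Cmod 1 <= 1) by (rewrite Cmod_1; lra).
  split.
  - apply holomorphic_iff; intros z Hz; apply cdiff_minus.
    + apply holomorphic_iff; [apply classP_inv|]; auto.
    + apply cdiff_mult; [apply cdiff_const | now apply herglotz_diff].
  - intros z Hz; specialize (Hp z Hz); specialize (HJ z Hz).
    assert (N := Re_pos_neq_0 _ Hp).
    unfold Cminus; rewrite re_plus, re_opp, re_scal_l, Re_inv.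
    unfold herglotz; rewrite Cmult_1_l, Re_cayley by exact Hz.
    assert (Q0 : 0 < Cmod (q z)) by now apply Cmod_gt_0.
    assert (W0 : 0 < Cmod (1 - z)) by now apply Cmod_gt_0, one_minus_neq_0.
    assert (Q : 0 < Cmod (q z) ^ 2) by now apply pow_lt.
    assert (W : 0 < Cmod (1 - z) ^ 2) by now apply pow_lt.
    replace (_ + _) with ((2 * a * Re (q z) * Cmod (1 - z) ^ 2 - (1 - Cmod z ^ 2) * Cmod (q z) ^ 2)
       / (2 * a * Cmod (q z) ^ 2 * Cmod (1 - z) ^ 2)).
    + apply Rmult_le_pos; [lra|]; left; apply Rinv_0_lt_compat.
      repeat apply Rmult_lt_0_compat; lra.
    + unfold Cminus in *; field; repeat split; lra.
Qed.

(** The values at [tau] of the kernels with |om| <= 1 fill a closed disc in the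
    right half-plane; with w = 1 / (delta g), solving herglotz om tau = w gives
    om tau = (w - 1) / (w + 1) = (1 - delta g) / (1 + delta g).  The
    inequality on [g] is the condition |om| <= 1 after division by delta. *)
Lemma interpolating_parameter (tau g : C) :
  tau <> 0 -> unit_disc tau -> 0 < Re g ->
  let delta := 1 - Cmod tau ^ 2 in
  1 + delta ^ 2 * Cmod g ^ 2 + 2 * delta * Re g <= 4 * Re g ->
  exists om, Cmod om <= 1 /\ herglotz om tau = (/ (delta * g))%C /\
    Cmod (om - 1) <= (Cmod (1 - tau) + 2 * delta * Cmod g) / Cmod tau.
Proof.
  intros Ht Hd Hg delta Hc; unfold unit_disc in Hd.
  assert (Hdel : 0 < delta) by (unfold delta; assert (P := Cmod_ge_0 tau); nra).
  assert (Htp : 0 < Cmod tau) by now apply Cmod_gt_0.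
  assert (Hgn := Re_pos_neq_0 _ Hg).
  assert (Hdn : RtoC delta <> 0) by (intros E; apply RtoC_inj in E; lra).
  assert (R1 : 1 <= Re (1 + delta * g)%C).
  { rewrite re_plus, re_scal_l, re_RtoC; nra. }
  assert (N1 : (1 + delta * g)%C <> 0) by (apply Re_pos_neq_0; lra).
  assert (M1 : 1 <= Cmod (1 + delta * g)).
  { eapply Rle_trans; [exact R1|]; eapply Rle_trans; [apply Rle_abs | apply re_le_Cmod]. }
  exists ((1 - delta * g) / (tau * (1 + delta * g)))%C.
  split; [|split].
  - rewrite Cmod_div by now apply Cmult_neq_0.
    rewrite Cmod_mult.
    apply Rmult_le_reg_r with (Cmod tau * Cmod (1 + delta * g)); [nra|].
    unfold Rdiv; rewrite Rmult_assoc, Rinv_l, Rmult_1_r, Rmult_1_l by nra.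
    apply Rle_of_sqr_le; [nra|].
    rewrite Rpow_mult_distr.
    replace (Cmod tau ^ 2) with (1 - delta) by (unfold delta; ring).
    assert (E1 : Cmod (1 - delta * g) ^ 2 = 1 - 2 * delta * Re g + delta ^ 2 * Cmod g ^ 2)
      by (rewrite !Cmod2_alt; unfold Re, Im; simpl; ring).
    assert (E2 : Cmod (1 + delta * g) ^ 2 = 1 + 2 * delta * Re g + delta ^ 2 * Cmod g ^ 2)
      by (rewrite !Cmod2_alt; unfold Re, Im; simpl; ring).
    rewrite E1, E2.
    assert (0 <= delta * (4 * Re g - (1 + delta ^ 2 * Cmod g ^ 2 + 2 * delta * Re g)))
      by (apply Rmult_le_pos; lra).
    lra.
  - unfold herglotz.
    replace ((1 - delta * g) / (tau * (1 + delta * g)) * tau)%C with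
      ((1 - delta * g) / (1 + delta * g))%C by (field; auto).
    field; repeat split; auto.
    replace (1 + delta * g - (1 - delta * g))%C with (2 * (delta * g))%C by ring.
    apply Cmult_neq_0; [|now apply Cmult_neq_0].
    intros E; apply RtoC_inj in E; lra.
  - replace ((1 - delta * g) / (tau * (1 + delta * g)) - 1)%C with
      ((1 - tau - (1 + tau) * (delta * g)) / (tau * (1 + delta * g)))%C by (field; auto).
    rewrite Cmod_div by now apply Cmult_neq_0.
    rewrite Cmod_mult.
    unfold Rdiv; apply Rmult_le_compat;
      [apply Cmod_ge_0 | left; apply Rinv_0_lt_compat; nra | | apply Rinv_le_contravar; nra].
    eapply Rle_trans; [apply Cmod_triangle_sub|].
    rewrite !Cmod_mult, Cmod_R, (Rabs_pos_eq delta) by lra.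
    assert (T := Cmod_triangle 1 tau); rewrite Cmod_1 in T.
    assert (0 <= delta * Cmod g) by (apply Rmult_le_pos; [lra | apply Cmod_ge_0]).
    nra.
Qed.

(** * Approximants with a prescribed value *)

Lemma small_multiple (e K : R) : 0 < e -> 0 <= K -> exists d, 0 < d /\ forall t, 0 <= t < d -> t * K < e.
Proof.
  intros He HK; exists (e / (K + 1)); split; [apply Rdiv_lt_0_compat; lra|].
  intros t [Ht0 Ht].
  apply Rmult_lt_compat_r with (r := K + 1) in Ht; [|lra].
  unfold Rdiv in Ht; rewrite Rmult_assoc, Rinv_l in Ht by lra; lra.
Qed.

Lemma dilation_close p r e :
  (forall z, unit_disc z -> cdiff p z) -> 0 <= r < 1 -> 0 < e ->
  exists s, 0 < s < 1 /\ forall z, Cmod z <= r -> Cmod (p (s * z)%C - p z) < e.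
Proof.
  intros Hp Hr He.
  destruct (ccont_uniform p r e) as (d & Hd & K); [|exact He|].
  { intros z Hz; apply cdiff_ccont, Hp; unfold unit_disc; lra. }
  assert (A1 := Rmin_l d 1); assert (A2 := Rmin_r d 1).
  assert (A3 : 0 < Rmin d 1) by (apply Rmin_pos; lra).
  exists (1 - Rmin d 1 / 2); split; [lra|]; intros z Hz; apply K; [exact Hz|].
  replace ((1 - Rmin d 1 / 2)%R * z - z)%C with ((- (Rmin d 1 / 2))%R * z)%C.
  - rewrite Cmod_mult, Cmod_R, Rabs_Ropp, Rabs_pos_eq by lra.
    assert (P := Cmod_ge_0 z); nra.
  - rewrite RtoC_minus, RtoC_opp; ring.
Qed.

Lemma dilation_classP p s : classP p -> 0 < s < 1 -> classP (fun z => p (s * z)%C).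
Proof.
  intros [Hh Hre] Hs.
  assert (Hin : forall z, unit_disc z -> unit_disc (s * z)%C).
  { unfold unit_disc; intros z Hz; rewrite Cmod_mult, Cmod_R, Rabs_pos_eq by lra.
    assert (P := Cmod_ge_0 z); nra. }
  split; [|intros z Hz; apply Hre; auto].
  apply holomorphic_iff; intros z Hz; apply (cdiff_comp_scal p s z).
  now apply holomorphic_iff; [|apply Hin].
Qed.

(** The slack [e] in Re G0 >= (1 + e) / 4 absorbs both the error terms of order
    delta in the condition of [interpolating_parameter] and the perturbation of
    [G0] by the factor 1 / (1 - x). *)
Lemma perturbed_parameter (G0 x : C) (delta e : R) :
  0 < e <= 1 -> (1 + e) / 4 <= Re G0 -> 0 < delta <= 1 -> Cmod x <= / 2 ->
  delta * (4 * Cmod G0 ^ 2 + 4 * Cmod G0) + 8 * Cmod G0 * Cmod x <= e ->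
  let g := (G0 / (1 - x))%C in
  0 < Re g /\ Cmod g <= 2 * Cmod G0 /\
  1 + delta ^ 2 * Cmod g ^ 2 + 2 * delta * Re g <= 4 * Re g.
Proof.
  intros He HG Hd Hx Hsmall g.
  assert (L := one_minus_lower x (/ 2) Hx).
  assert (Hn : (1 - x)%C <> 0) by (apply Cmod_gt_0; lra).
  assert (N0 := Cmod_ge_0 G0); assert (X0 := Cmod_ge_0 x).
  assert (Hinv : / Cmod (1 - x) <= 2).
  { rewrite <- (Rinv_inv 2); apply Rinv_le_contravar; lra. }
  assert (Hg : Cmod g <= 2 * Cmod G0).
  { unfold g; rewrite Cmod_div by exact Hn; unfold Rdiv; nra. }
  assert (Hdiff : Cmod (G0 - g) <= 2 * Cmod G0 * Cmod x).
  { replace (G0 - g)%C with (- (g * x))%C by (unfold g; field; exact Hn).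
    rewrite Cmod_opp, Cmod_mult; apply Rmult_le_compat_r; lra. }
  assert (HRe : Re G0 - 2 * Cmod G0 * Cmod x <= Re g).
  { assert (A := re_le_Cmod (G0 - g)); assert (B := Rle_abs (Re (G0 - g))).
    unfold Cminus in B, A; rewrite re_plus, re_opp in B; rewrite re_plus, re_opp in A.
    unfold Cminus in Hdiff; lra. }
  assert (HRe2 : Re g <= 2 * Cmod G0).
  { eapply Rle_trans; [apply Rle_abs|]; eapply Rle_trans; [apply re_le_Cmod | exact Hg]. }
  assert (G2 : Cmod g ^ 2 <= (2 * Cmod G0) ^ 2) by (apply pow_incr; split; [apply Cmod_ge_0 | exact Hg]).
  assert (Hpos : 0 <= delta * (4 * Cmod G0 ^ 2 + 4 * Cmod G0)).
  { apply Rmult_le_pos; [lra|]; nra. }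
  split; [lra|split; [exact Hg|]].
  assert (D2 : delta ^ 2 * Cmod g ^ 2 <= delta * (2 * Cmod G0) ^ 2).
  { apply Rmult_le_compat; [apply pow2_ge_0 | apply pow2_ge_0 | nra | exact G2]. }
  assert (D1 : 2 * delta * Re g <= 2 * delta * (2 * Cmod G0)) by (apply Rmult_le_compat_l; lra).
  nra.
Qed.

Lemma inverse_close (h k : C) (c Q e : R) :
  k <> 0 -> 0 < c -> c <= Re h -> Cmod k <= Q -> Cmod (h - / k) * Q < e * c ->
  Cmod (/ h - k) < e.
Proof.
  intros Hk Hc Hh HQ Hlt.
  assert (Hn : h <> 0) by (apply Re_pos_neq_0; lra).
  assert (Hm : c <= Cmod h).
  { eapply Rle_trans; [exact Hh|]; eapply Rle_trans; [apply Rle_abs | apply re_le_Cmod]. }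
  replace (/ h - k)%C with (- ((h - / k) * k) / h)%C by (field; auto).
  rewrite Cmod_div, Cmod_opp, Cmod_mult by exact Hn.
  assert (P := Cmod_ge_0 (h - / k)).
  apply Rmult_lt_reg_r with (Cmod h); [lra|].
  unfold Rdiv; rewrite Rmult_assoc, Rinv_l, Rmult_1_r by lra.
  assert (Cmod (h - / k) * Cmod k <= Cmod (h - / k) * Q) by (apply Rmult_le_compat_l; lra).
  assert (He : 0 < e).
  { assert (0 <= Cmod (h - / k) * Q); [|nra].
    apply Rmult_le_pos; [lra|]; eapply Rle_trans; [apply Cmod_ge_0 | exact HQ]. }
  nra.
Qed.

(** The approximant is the inverse of
    h = m (1 + k) herglotz om + p (s z), with m = 1 / (2 a) and p the remainder.
    The increase k of the weight is needed in the extremal case Re gamma = a / 2,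
    where weight m alone can just miss the required value; the dilation s keeps
    p (s tau) bounded although p may be wild at 1.  The numbers k and s are fixed
    first, by [r] and [e]; [tau] close to 1 then gives an admissible om close to 1. *)
Lemma interpolating_approximant q a gamma r e :
  0 < a -> a / 2 <= Re gamma ->
  holomorphic_on_disc q -> (forall z, unit_disc z -> 0 < Re (q z)) ->
  classP (fun z => / q z - RtoC (/ (2 * a)) * herglotz 1 z)%C ->
  0 <= r < 1 -> 0 < e ->
  exists eta, 0 < eta /\ forall tau, unit_disc tau -> Cmod (1 - tau) < eta ->
    exists f, classP f /\ f tau = (gamma * RtoC (1 - Cmod tau ^ 2))%C /\
      forall z, Cmod z <= r -> Cmod (f z - q z) < e.
Proof.
  intros Ha Hgam Hhol Hpos HP Hr He.
  set (m := / (2 * a)) in *.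
  assert (Hm : 0 < m) by (apply Rinv_0_lt_compat; lra).
  assert (Hma : m * a = / 2) by (unfold m; field; lra).
  set (p := fun z => (/ q z - m * herglotz 1 z)%C) in *.
  assert (Hpd : forall z, unit_disc z -> cdiff p z) by (apply holomorphic_iff, HP).
  assert (Hqd := proj1 (holomorphic_iff q) Hhol).
  destruct (ccont_bounded q r) as (Q & HQ0 & HQ); [lra| |].
  { intros z Hz; apply cdiff_ccont, Hqd; unfold unit_disc; lra. }
  pose (c := m * ((1 - r ^ 2) / 4)).
  assert (Hc : 0 < c) by (apply Rmult_lt_0_compat; nra).
  pose (e1 := e * c / (2 * Q)).
  assert (He1 : 0 < e1) by (apply Rdiv_lt_0_compat; [apply Rmult_lt_0_compat|]; lra).
  assert (He1Q : e1 * Q < e * c).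
  { replace (e1 * Q) with (e * c / 2) by (unfold e1; field; lra).
    assert (0 < e * c) by (apply Rmult_lt_0_compat; lra); lra. }
  (* The error e1 of 1 / q is split among the extra mass k, the dilation s and
     the displacement of om. *)
  destruct (small_multiple (e1 / 4) (m * (2 / (1 - r)))) as (d1 & Hd1 & K1); [lra| |].
  { apply Rmult_le_pos; [lra|]; left; apply Rdiv_lt_0_compat; lra. }
  pose (k := Rmin 1 (d1 / 2)).
  assert (Hk : 0 < k <= 1) by (split; [apply Rmin_pos; lra | apply Rmin_l]).
  assert (Hk1 : k * (m * (2 / (1 - r))) < e1 / 4).
  { apply K1; split; [lra|]; apply Rle_lt_trans with (d1 / 2); [apply Rmin_r | lra]. }
  destruct (dilation_close p r (e1 / 4) Hpd Hr ltac:(lra)) as (s & Hs & Hsp).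
  destruct (ccont_bounded p s) as (B & HB0 & HB); [lra| |].
  { intros z Hz; apply cdiff_ccont, Hpd; unfold unit_disc; lra. }
  pose (G0 := (RtoC (m * (1 + k)) * gamma)%C).
  assert (HG0 : (1 + k) / 4 <= Re G0).
  { unfold G0; rewrite re_scal_l.
    assert (m * (a / 2) <= m * Re gamma) by (apply Rmult_le_compat_l; lra). nra. }
  assert (N0 := Cmod_ge_0 G0); assert (Ng := Cmod_ge_0 gamma).
  assert (GB : 0 <= Cmod gamma * B) by (apply Rmult_le_pos; lra).
  destruct (small_multiple (/ 2) (2 * (Cmod gamma * B))) as (d2 & Hd2 & K2); [lra | lra |].
  destruct (small_multiple k (2 * (4 * Cmod G0 ^ 2 + 4 * Cmod G0 + 8 * Cmod G0 * (Cmod gamma * B))))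
    as (d3 & Hd3 & K3); [lra| |].
  { assert (0 <= Cmod G0 * (Cmod gamma * B)) by (apply Rmult_le_pos; lra). nra. }
  destruct (small_multiple (e1 / 4) (2 * m * (2 * (2 * (1 + 8 * Cmod G0)) / (1 - r) ^ 2)))
    as (d4 & Hd4 & K4); [lra| |].
  { apply Rmult_le_pos; [lra|]; left; apply Rdiv_lt_0_compat; [lra | apply pow_lt; lra]. }
  exists (Rmin (/ 2) (Rmin d2 (Rmin d3 d4))); split.
  { repeat apply Rmin_pos; lra. }
  intros tau Htau Hclose.
  set (t := Cmod (1 - tau)) in *.
  assert (Ht0 : 0 <= t) by apply Cmod_ge_0.
  assert (Ht1 : t < / 2) by (eapply Rlt_le_trans; [exact Hclose | apply Rmin_l]).
  assert (Htr : t < Rmin d2 (Rmin d3 d4)) by (eapply Rlt_le_trans; [exact Hclose | apply Rmin_r]).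
  assert (Ht2 : t < d2) by (eapply Rlt_le_trans; [exact Htr | apply Rmin_l]).
  assert (Htr' : t < Rmin d3 d4) by (eapply Rlt_le_trans; [exact Htr | apply Rmin_r]).
  assert (Ht3 : t < d3) by (eapply Rlt_le_trans; [exact Htr' | apply Rmin_l]).
  assert (Ht4 : t < d4) by (eapply Rlt_le_trans; [exact Htr' | apply Rmin_r]).
  specialize (K2 t (conj Ht0 Ht2)); specialize (K3 t (conj Ht0 Ht3)).
  specialize (K4 t (conj Ht0 Ht4)); clear Hclose Htr Htr'.
  assert (Htm : 1 - t <= Cmod tau).
  { assert (A := Cmod_triangle_inv 1 (1 - tau)); rewrite Cmod_1 in A.
    replace (1 - (1 - tau))%C with tau in A by ring; exact A. }
  assert (Htau1 : Cmod tau < 1) by exact Htau.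
  set (delta := 1 - Cmod tau ^ 2) in *.
  assert (Hdel : 0 < delta <= 2 * t) by (unfold delta; nra).
  assert (Htn : tau <> 0) by (apply Cmod_gt_0; lra).
  assert (Hgn : gamma <> 0) by (apply Re_pos_neq_0; lra).
  assert (Hdn : RtoC delta <> 0) by (intros E; apply RtoC_inj in E; lra).
  (* h tau = 1 / (gamma delta) amounts to
     m (1 + k) herglotz om tau = (1 - x) / (gamma delta) = m (1 + k) / (delta g). *)
  pose (x := (gamma * delta * p (s * tau))%C).
  assert (Hx : Cmod x <= delta * (Cmod gamma * B)).
  { unfold x; rewrite !Cmod_mult, (Cmod_R delta), (Rabs_pos_eq delta) by lra.
    assert (A : Cmod (p (s * tau)%C) <= B).
    { apply HB; rewrite Cmod_mult, Cmod_R, Rabs_pos_eq by lra; nra. }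
    replace (delta * (Cmod gamma * B)) with (Cmod gamma * delta * B) by ring.
    apply Rmult_le_compat_l; [apply Rmult_le_pos; lra | exact A]. }
  assert (Hx2 : delta * (Cmod gamma * B) <= 2 * t * (Cmod gamma * B))
    by (apply Rmult_le_compat_r; lra).
  destruct (perturbed_parameter G0 x delta k) as (Hg1 & Hg2 & Hg3); auto; try lra.
  { assert (A1 : 8 * Cmod G0 * Cmod x <= 8 * Cmod G0 * (2 * t * (Cmod gamma * B)))
      by (apply Rmult_le_compat_l; lra).
    assert (A2 : delta * (4 * Cmod G0 ^ 2 + 4 * Cmod G0) <= 2 * t * (4 * Cmod G0 ^ 2 + 4 * Cmod G0))
      by (apply Rmult_le_compat_r; nra).
    lra. }
  set (g := (G0 / (1 - x))%C) in *.
  destruct (interpolating_parameter tau g Htn Htau Hg1 Hg3) as (om & Hom & Hval & Homc).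
  fold t delta in Homc, Hval.
  assert (Hom1 : Cmod (om - 1) <= 2 * t * (1 + 8 * Cmod G0)).
  { eapply Rle_trans; [exact Homc|].
    apply Rmult_le_reg_r with (Cmod tau); [lra|].
    unfold Rdiv; rewrite Rmult_assoc, Rinv_l, Rmult_1_r by lra.
    assert (A : 2 * delta * Cmod g <= 2 * (2 * t) * (2 * Cmod G0)).
    { apply Rmult_le_compat; [lra | apply Cmod_ge_0 | lra | lra]. }
    assert (0 <= t * (1 + 8 * Cmod G0)) by (apply Rmult_le_pos; lra).
    nra. }
  pose (h := fun z => (RtoC (m * (1 + k)) * herglotz om z + p (s * z))%C).
  assert (Hdil := dilation_classP p s HP Hs).
  assert (Hlow : forall z, unit_disc z -> m * ((1 - Cmod z ^ 2) / 4) <= Re (h z)).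
  { intros z Hz; unfold h; rewrite re_plus, re_scal_l.
    assert (A := proj2 Hdil z Hz); cbv beta in A.
    assert (L := herglotz_Re_lower om z Hom Hz).
    assert (Z : 0 <= (1 - Cmod z ^ 2) / 4).
    { unfold unit_disc in Hz; assert (P := Cmod_ge_0 z); nra. }
    assert (m * ((1 - Cmod z ^ 2) / 4) <= m * Re (herglotz om z)) by (apply Rmult_le_compat_l; lra).
    assert (0 <= m * k * Re (herglotz om z)) by (apply Rmult_le_pos; [apply Rmult_le_pos|]; lra).
    lra. }
  exists (fun z => / h z)%C; split; [|split].
  - apply classP_inv.
    + apply holomorphic_iff; intros z Hz; apply cdiff_plus.
      * apply cdiff_mult; [apply cdiff_const | now apply herglotz_diff].
      * apply (proj1 (holomorphic_iff _) (proj1 Hdil) z Hz).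
    + intros z Hz; eapply Rlt_le_trans; [|now apply Hlow].
      unfold unit_disc in Hz; assert (P := Cmod_ge_0 z); apply Rmult_lt_0_compat; nra.
  - assert (Hmk : RtoC (m * (1 + k)) <> 0).
    { intros E; apply RtoC_inj in E; nra. }
    assert (Hx1 : (1 - x)%C <> 0).
    { apply Cmod_gt_0; assert (A := one_minus_lower x (/ 2) ltac:(lra)); lra. }
    assert (Eh : h tau = (/ (gamma * delta))%C).
    { unfold h; rewrite Hval; unfold g, G0.
      transitivity ((1 - x) / (gamma * delta) + p (s * tau))%C; [field; auto|].
      unfold x; field; auto. }
    rewrite Eh; field; auto.
  - intros z Hz.
    assert (Hzd : unit_disc z) by (unfold unit_disc; lra).
    apply inverse_close with c Q; auto.
    + now apply Re_pos_neq_0, Hpos.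
    + eapply Rle_trans; [|now apply Hlow]; unfold c; apply Rmult_le_compat_l; [lra|].
      assert (P := Cmod_ge_0 z); nra.
    + apply Rle_lt_trans with (e1 * Q); [|exact He1Q].
      apply Rmult_le_compat_r; [lra|].
      replace (h z - / q z)%C with
        (RtoC (m * (1 + k)) * (herglotz om z - herglotz 1 z) + RtoC (m * k) * herglotz 1 z
          + (p (s * z) - p z))%C.
      2: { unfold h; unfold p at 2; rewrite !RtoC_mult, !RtoC_plus; ring. }
      eapply Rle_trans; [apply Cmod_triangle|].
      eapply Rle_trans; [apply Rplus_le_compat_r, Cmod_triangle|].
      rewrite !Cmod_mult, !Cmod_R, !Rabs_pos_eq by (apply Rmult_le_pos; lra).
      assert (T1 := herglotz_close om z r Hom Hz (proj2 Hr)).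
      assert (T2 := herglotz_bound 1 z r ltac:(rewrite Cmod_1; lra) Hz (proj2 Hr)).
      specialize (Hsp z Hz).
      assert (U2 : m * k * Cmod (herglotz 1 z) <= e1 / 4).
      { apply Rle_trans with (m * k * (2 / (1 - r))); [|lra].
        apply Rmult_le_compat_l; [apply Rmult_le_pos; lra | exact T2]. }
      assert (U1 : m * (1 + k) * Cmod (herglotz om z - herglotz 1 z) <= e1 / 4).
      { apply Rle_trans with (2 * m * (2 * (2 * t * (1 + 8 * Cmod G0)) / (1 - r) ^ 2)).
        - apply Rmult_le_compat; [apply Rmult_le_pos; lra | apply Cmod_ge_0 | nra|].
          eapply Rle_trans; [exact T1|].
          unfold Rdiv; apply Rmult_le_compat_r; [left; apply Rinv_0_lt_compat, pow_lt; lra | lra].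
        - left; eapply Rle_lt_trans; [|exact K4]; right; field; lra. }
      lra.
Qed.

(** * Diagonal choice and the theorem *)

Lemma compactC_in_smaller_disc K :
  compactC K -> (forall z, K z -> unit_disc z) ->
  exists r, r < 1 /\ forall z, K z -> Cmod z <= r.
Proof.
  intros HK Hd.
  destruct (HK nat (fun n z => Cmod z < 1 - / (INR n + 1))) as [l Hl].
  - intros n z Hz; apply locally_C_Cmod.
    exists (1 - / (INR n + 1) - Cmod z); split; [lra|]; intros w Hw.
    assert (T := Cmod_triangle_inv w z); lra.
  - intros z Hz; specialize (Hd z Hz); unfold unit_disc in Hd.
    destruct (INR_unbounded (/ (1 - Cmod z))) as [n Hn]; exists n.
    assert (P : 0 < / (1 - Cmod z)) by (apply Rinv_0_lt_compat; lra).
    assert (A : / (INR n + 1) < / / (1 - Cmod z)).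
    { apply Rinv_lt_contravar; [|lra]; apply Rmult_lt_0_compat; lra. }
    rewrite Rinv_inv in A; lra.
  - assert (H : exists r, r < 1 /\ forall n, In n l -> 1 - / (INR n + 1) <= r).
    { clear Hl; induction l as [|k l (r & Hr & IH)].
      - exists 0; split; [lra|]; intros n [].
      - exists (Rmax r (1 - / (INR k + 1))); split.
        + apply Rmax_lub_lt; [exact Hr|].
          assert (0 < / (INR k + 1)) by (apply Rinv_0_lt_compat; assert (P := pos_INR k); lra).
          lra.
        + intros n [<-|Hn]; [apply Rmax_r|].
          eapply Rle_trans; [now apply IH | apply Rmax_l]. }
    destruct H as (r & Hr & H); exists r; split; [exact Hr|]; intros z Hz.
    destruct (Hl z Hz) as (n & Hn & Hzn); specialize (H n Hn); lra.
Qed.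

(** One witness can serve all solvable levels n <= N at once: the one for the
    largest of them. *)
Lemma best_witness (X : Type) (P : nat -> X -> Prop) (B : X -> Prop) (N : nat) :
  (exists x, B x) -> (forall n k x, (k <= n)%nat -> P n x -> P k x) ->
  exists x, B x /\ forall n, (n <= N)%nat -> (exists y, B y /\ P n y) -> P n x.
Proof.
  intros HB Hmono; induction N as [|N (x & Hx & IH)].
  - destruct (classic (exists y, B y /\ P O y)) as [(y & Hy & HP)|Hno].
    + exists y; split; [exact Hy|]; intros n Hn _; now apply Hmono with O.
    + destruct HB as [x Hx]; exists x; split; [exact Hx|]; intros n Hn Hex.
      replace n with O in Hex by lia; contradiction.
  - destruct (classic (exists y, B y /\ P (S N) y)) as [(y & Hy & HP)|Hno].
    + exists y; split; [exact Hy|]; intros n Hn _; now apply Hmono with (S N).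
    + exists x; split; [exact Hx|]; intros n Hn Hex; apply IH; [|exact Hex].
      destruct (Nat.eq_dec n (S N)) as [->|Hne]; [contradiction | lia].
Qed.

(** The approximants for a given accuracy become available only near 1.  For each
    [tau] take one that is optimal among the accuracies 1 / (n + 1) with
    n <= 1 / |1 - tau|; every accuracy is eventually considered and solvable. *)
Lemma diagonal_family q (v : C -> C) :
  (forall tau, unit_disc tau -> 0 <= Re (v tau)) ->
  (forall r e, 0 <= r < 1 -> 0 < e ->
    exists eta, 0 < eta /\ forall tau, unit_disc tau -> Cmod (1 - tau) < eta ->
      exists f, classP f /\ f tau = v tau /\ forall z, Cmod z <= r -> Cmod (f z - q z) < e) ->
  exists qt : C -> C -> C,
    (forall tau, unit_disc tau -> classP (qt tau) /\ qt tau tau = v tau) /\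
    cvg_loc_unif (to_one unit_disc) qt q.
Proof.
  intros Hv Happ.
  pose (P := fun n (f : C -> C) =>
    forall z, Cmod z <= 1 - / (INR n + 1) -> Cmod (f z - q z) < / (INR n + 1)).
  assert (Hn1 : forall n, 0 < / (INR n + 1) <= 1).
  { intros n; assert (A := pos_INR n); split; [apply Rinv_0_lt_compat; lra|].
    rewrite <- Rinv_1; apply Rinv_le_contravar; lra. }
  assert (Hmono : forall n k f, (k <= n)%nat -> P n f -> P k f).
  { intros n k f Hkn HP z Hz.
    assert (A : / (INR n + 1) <= / (INR k + 1)).
    { apply le_INR in Hkn; apply Rinv_le_contravar; [|lra].
      assert (B := pos_INR k); lra. }
    eapply Rlt_le_trans; [apply HP|]; lra. }
  destruct (choice_function C (C -> C) (fun tau f => unit_disc tau ->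
     (classP f /\ f tau = v tau) /\
     forall n, INR n <= / Cmod (1 - tau) -> (exists g, (classP g /\ g tau = v tau) /\ P n g) ->
       P n f)) as [qt Hqt].
  { intros tau; destruct (classic (unit_disc tau)) as [Htau|Hout].
    2: { exists (fun _ => RtoC 0); tauto. }
    destruct (INR_unbounded (/ Cmod (1 - tau))) as [N HN].
    destruct (best_witness _ P (fun f => classP f /\ f tau = v tau) N) as (f & Hf & Hbest).
    - exists (fun _ => v tau); split; [split|reflexivity].
      + apply holomorphic_iff; intros z _; apply cdiff_const.
      + intros z _; now apply Hv.
    - exact Hmono.
    - exists f; intros _; split; [exact Hf|]; intros n Hn Hex; apply Hbest; [|exact Hex].
      apply INR_le; lra. }
  exists qt; split; [intros tau Htau; now apply Hqt|].
  intros K HK Hd e He.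
  destruct (compactC_in_smaller_disc K HK Hd) as (r & Hr & HKr).
  destruct (INR_unbounded (/ Rmin e (1 - r))) as [n Hn].
  assert (Hmin : 0 < Rmin e (1 - r)) by (apply Rmin_pos; lra).
  assert (Hsmall : / (INR n + 1) < Rmin e (1 - r)).
  { assert (A : 0 < / Rmin e (1 - r)) by now apply Rinv_0_lt_compat.
    rewrite <- (Rinv_inv (Rmin e (1 - r))); apply Rinv_lt_contravar; [|lra].
    apply Rmult_lt_0_compat; lra. }
  assert (S1 := Rmin_l e (1 - r)); assert (S2 := Rmin_r e (1 - r)).
  specialize (Hn1 n).
  destruct (Happ (1 - / (INR n + 1)) (/ (INR n + 1))) as (eta & Heta & Hex); [lra|lra|].
  apply locally_C_Cmod; exists (Rmin eta (/ (INR n + 1))); split; [apply Rmin_pos; lra|].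
  intros tau Hclose Htau z Hz.
  rewrite Cmod_sub_comm in Hclose.
  assert (C1 : Cmod (1 - tau) < eta) by (eapply Rlt_le_trans; [exact Hclose | apply Rmin_l]).
  assert (C2 : Cmod (1 - tau) < / (INR n + 1))
    by (eapply Rlt_le_trans; [exact Hclose | apply Rmin_r]).
  assert (C0 : 0 < Cmod (1 - tau)) by now apply Cmod_gt_0, one_minus_neq_0.
  assert (C3 : INR n <= / Cmod (1 - tau)).
  { apply Rle_trans with (INR n + 1); [lra|].
    rewrite <- (Rinv_inv (INR n + 1)); apply Rinv_le_contravar; lra. }
  destruct (Hex tau Htau C1) as (f & Hf1 & Hf2 & Hf3).
  assert (HP : P n (qt tau)).
  { apply (Hqt tau Htau); [exact C3|]; exists f; auto. }
  specialize (HKr z Hz); specialize (HP z ltac:(lra)); lra.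
Qed.

Theorem theorem3p1 :
  forall q : C -> C,
    classP q ->
    angular_lim q (RtoC 0) ->
    conformal_at_one q ->
    forall alpha : C,
      angular_derivative q (- alpha)%C ->
      (Im alpha = 0 /\ 0 < Re alpha) /\
      forall gamma : C,
        Re alpha / 2 <= Re gamma ->
        exists qt : C -> C -> C,
          (forall tau : C, unit_disc tau -> classP (qt tau)) /\
          cvg_loc_unif (to_one unit_disc) qt q /\
          (forall tau : C, unit_disc tau ->
             qt tau tau = (gamma * RtoC (1 - Cmod tau ^ 2))%C) /\
          filterlim (fun tau : C => qt tau tau) (to_one unit_disc)
            (locally (RtoC 0)) /\
          (Im gamma = 0 -> forall tau : C, unit_disc tau -> Im (qt tau tau) = 0).
Proof.
  intros q Hq H0 Hc alpha Hd.
  destruct (angular_derivative_positive q alpha Hq Hc Hd) as [HI Ha].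
  split; [now split|]; intros gamma Hg.
  assert (Hpos : forall z, unit_disc z -> 0 < Re (q z)).
  { intros z; now apply Re_pos_of_angular_derivative with alpha. }
  assert (HP := remainder_classP q (Re alpha) Ha (proj1 Hq) Hpos
    (fun z Hz => julia_inequality q alpha z Hq H0 Hd Hz)).
  assert (Hdelta : forall tau, unit_disc tau -> 0 < 1 - Cmod tau ^ 2 <= 2 * Cmod (tau - 1)).
  { intros tau Htau; unfold unit_disc in Htau; assert (A := Cmod_ge_0 tau).
    assert (T := Cmod_triangle_inv 1 tau); rewrite Cmod_1, Cmod_sub_comm in T; nra. }
  destruct (diagonal_family q (fun tau => gamma * RtoC (1 - Cmod tau ^ 2))%C) as (qt & Hqt & Hcvg).
  - intros tau Htau; rewrite re_scal_r; specialize (Hdelta tau Htau).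
    apply Rmult_le_pos; lra.
  - intros r e Hr He; apply interpolating_approximant with (Re alpha); auto; apply Hq.
  - exists qt; repeat split.
    + now apply Hqt.
    + now apply Hqt.
    + exact Hcvg.
    + intros tau Htau; now apply Hqt.
    + intros P HP0; apply locally_C_Cmod in HP0; destruct HP0 as (e & He & HPe).
      apply locally_C_Cmod.
      destruct (small_multiple e (2 * Cmod gamma)) as (d & Hd0 & Hsmall).
      { exact He. }
      { assert (A := Cmod_ge_0 gamma); lra. }
      exists d; split; [exact Hd0|]; intros tau Hclose Htau; apply HPe.
      rewrite (proj2 (Hqt tau Htau)); cbv beta; specialize (Hdelta tau Htau).
      replace (gamma * RtoC (1 - Cmod tau ^ 2) - 0)%C with
        (gamma * RtoC (1 - Cmod tau ^ 2))%C by ring.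
      rewrite Cmod_mult, Cmod_R, Rabs_pos_eq by lra.
      specialize (Hsmall (Cmod (tau - 1)) (conj (Cmod_ge_0 _) Hclose)).
      assert (Cmod gamma * (1 - Cmod tau ^ 2) <= Cmod gamma * (2 * Cmod (tau - 1)))
        by (apply Rmult_le_compat_l; [apply Cmod_ge_0 | lra]).
      lra.
    + intros HG tau Htau; rewrite (proj2 (Hqt tau Htau)); cbv beta.
      rewrite im_mult, HG; unfold Im, RtoC; simpl; ring.
Qed.
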